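(* Let $H$ be a finite graph and let $\mathcal{C}$ be a class of finite graphs none of which contains $H$ as a minor. The following are equivalent: (1) $\mathcal{C}$ is $\mathrm{MSO}_2$-orderable; (2) $\mathcal{C}$ has property $\mathsf{SEP}$; (3) $\mathcal{C}$ has property $\mathsf{SEP}(f)$ for some elementary function $f$.
   Context: Graphs are finite, simple, loop-free, undirected. For $G=\langle V,E\rangle$, $\lceil G\rceil=\langle V\cup E,\mathrm{inc}\rangle$ (universe $V\cup E$, incidence relation $\mathrm{inc}\subseteq V\times E$). An MSO-formula $\varphi(x,y;Z_0,\dots,Z_{n-1})$ defines an order on a class $\mathcal{C}$ of structures if for every non-empty $\mathfrak{A}\in\mathcal{C}$ there are $P_0,\dots,P_{n-1}\subseteq A$ such that $\{(a,b):\mathfrak{A}\models\varphi(a,b;\bar P)\}$ is a linear order on $A$; a graph class is $\mathrm{MSO}_2$-orderable if some MSO-formula defines an order on $\{\lceil G\rceil:G\in\mathcal{C}\}$. $\mathrm{Sep}(G,k)$ is the maximum over vertex sets $S$, $|S|\le k$, of the number of connected components of $G-S$; $\mathcal{C}$ has $\mathsf{SEP}(f)$ if $\mathrm{Sep}(G,k)\le f(k)$ for all $G\in\mathcal{C}$, $k\in\mathbb{N}$, and $\mathsf{SEP}$ if it has $\mathsf{SEP}(f)$ for some $f$. A function $f:\mathbb{N}\to\mathbb{N}$ is elementary if $f\le\exp_k$ for some fixed $k$, where $\exp_0(n)=n$, $\exp_{k+1}(n)=2^{\exp_k(n)}$. *)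

(* Defs.v *)
From mathcomp Require Import all_boot.
Set Implicit Arguments. Unset Strict Implicit. Unset Printing Implicit Defensive.

Record fin_graph := FGraph {
  gn : nat;
  gadj : rel 'I_gn;
  gsym : symmetric gadj;
  girr : irreflexive gadj }.
Arguments gadj : clear implicits.

Definition graph_class := fin_graph -> Prop.

Definition induced_rel (G : fin_graph) (S : {set 'I_(gn G)}) : rel 'I_(gn G) :=
  [rel a b | [&& a \in S, b \in S & gadj G a b]].

Definition connected_set (G : fin_graph) (S : {set 'I_(gn G)}) : Prop :=
  forall x y, x \in S -> y \in S -> connect (induced_rel S) x y.

Definition minor (H G : fin_graph) : Prop :=
  exists phi : 'I_(gn H) -> {set 'I_(gn G)},
    [/\ forall u, phi u != set0,
        forall u v, u != v -> [disjoint phi u & phi v],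
        forall u, connected_set (phi u) &
        forall u v, gadj H u v ->
          exists x y, [/\ x \in phi u, y \in phi v & gadj G x y]].

Definition del_rel (G : fin_graph) (S : {set 'I_(gn G)}) : rel 'I_(gn G) :=
  [rel a b | [&& a \notin S, b \notin S & gadj G a b]].

Definition ncomps (G : fin_graph) (S : {set 'I_(gn G)}) : nat :=
  #|[set [set y | connect (del_rel S) x y] | x in ~: S]|.

Definition Sep (G : fin_graph) (k : nat) : nat :=
  \max_(S : {set 'I_(gn G)} | #|S| <= k) ncomps S.

Definition has_SEPf (C : graph_class) (f : nat -> nat) : Prop :=
  forall G, C G -> forall k, Sep G k <= f k.

Definition has_SEP (C : graph_class) : Prop := exists f, has_SEPf C f.

Definition exp_iter (k n : nat) : nat := iter k (fun m => 2 ^ m) n.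

Definition elementary (f : nat -> nat) : Prop :=
  exists k, forall n, f n <= exp_iter k n.

Definition edge_type (G : fin_graph) :=
  {p : 'I_(gn G) * 'I_(gn G) | (p.1 < p.2) && gadj G p.1 p.2}.

Definition inc_univ (G : fin_graph) : finType := ('I_(gn G) + edge_type G)%type.

Definition inc_rel (G : fin_graph) : rel (inc_univ G) :=
  fun a b => match a, b with
             | inl v, inr ed => (v == (val ed).1) || (v == (val ed).2)
             | _, _ => false
             end.

Inductive mso : Type :=
| MEq  : nat -> nat -> mso
| MRel : nat -> nat -> mso
| MIn  : nat -> nat -> mso
| MNot : mso -> mso
| MAnd : mso -> mso -> mso
| MEx1 : nat -> mso -> mso
| MEx2 : nat -> mso -> mso.

Definition upd {T : Type} (v : nat -> T) (i : nat) (a : T) : nat -> T :=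
  fun k => if k == i then a else v k.

Fixpoint msat (A : finType) (R : rel A) (v1 : nat -> A) (v2 : nat -> {set A})
    (phi : mso) : Prop :=
  match phi with
  | MEq i j => v1 i = v1 j
  | MRel i j => R (v1 i) (v1 j)
  | MIn i X => v1 i \in v2 X
  | MNot p => ~ msat R v1 v2 p
  | MAnd p q => msat R v1 v2 p /\ msat R v1 v2 q
  | MEx1 i p => exists a : A, msat R (upd v1 i a) v2 p
  | MEx2 X p => exists P : {set A}, msat R v1 (upd v2 X P) p
  end.

Fixpoint fo_free_in (ok : pred nat) (phi : mso) : bool :=
  match phi with
  | MEq i j | MRel i j => ok i && ok j
  | MIn i _ => ok i
  | MNot p => fo_free_in ok p
  | MAnd p q => fo_free_in ok p && fo_free_in ok q
  | MEx1 i p => fo_free_in (fun k => (k == i) || ok k) p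
  | MEx2 _ p => fo_free_in ok p
  end.

Fixpoint so_free_in (ok : pred nat) (phi : mso) : bool :=
  match phi with
  | MEq _ _ | MRel _ _ => true
  | MIn _ X => ok X
  | MNot p => so_free_in ok p
  | MAnd p q => so_free_in ok p && so_free_in ok q
  | MEx1 _ p => so_free_in ok p
  | MEx2 X p => so_free_in (fun k => (k == X) || ok k) p
  end.

(* phi = phi(x, y; Z_0, ..., Z_{n-1}) with x = x_0, y = x_1, Z_j = X_j *)
Definition mso_formula_xy (n : nat) (phi : mso) : bool :=
  fo_free_in (fun k => k < 2) phi && so_free_in (fun k => k < n) phi.

Definition env_xy (A : Type) (a b : A) : nat -> A :=
  fun k => if k == 0 then a else b.

Definition linear_order (A : Type) (r : A -> A -> Prop) : Prop :=
  [/\ forall a, r a a,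
      forall a b, r a b -> r b a -> a = b,
      forall a b c, r a b -> r b c -> r a c &
      forall a b, r a b \/ r b a].

Definition mso_defines_order (C : graph_class) (n : nat) (phi : mso) : Prop :=
  forall G, C G -> 0 < #|inc_univ G| ->
    exists P : n.-tuple {set inc_univ G},
      linear_order (fun a b => msat (@inc_rel G) (env_xy a b) (nth set0 P) phi).

Definition MSO2_orderable (C : graph_class) : Prop :=
  exists n phi, mso_formula_xy n phi /\ mso_defines_order C n phi.

(* Main.v *)
Require Import Defs.
From mathcomp Require Import all_boot zify.
Set Implicit Arguments. Unset Strict Implicit. Unset Printing Implicit Defensive.

(** Orderability bounds [Sep]: if [G - S] has more components than there are pairs of
    MSO-types (with the elements of [S] named), two components contain elements [a], [b] of
    the same type, and exchanging the two pieces makes [(a, b)] and [(b, a)] satisfy the same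
    formulas, so no formula can order them.

    For classes without a K_h-minor, [SEP] already implies a linear bound. Contract
    components of [G - S] into [S] as long as each contraction creates a new edge on [S]; by
    Mader's density theorem this happens O(|S|) times. Every remaining component is attached
    to a clique of the contracted graph; that graph is degenerate, so it has O(|S|) cliques,
    and [SEP] bounds the number of components attached to each of them.

    A linear bound on the number of components of [G - S] yields, by the theorem of Win
    (in the proof of Ellingham and Zha), a connected spanning subgraph of bounded degree.
    The cube of a connected graph has a Hamiltonian path (Sekanina), whose successor relation
    is MSO-definable from the subgraph and a bounded colouring of its sixth power. *)

(** * Induced connectivity *)

(** The linear bound is itself elementary, which is how (3) follows from (2). A graph of the class
    may be disconnected, while a spanning walk needs connectivity. Taking [S] empty in the linear
    bound shows that there are boundedly many components, so one representative of each is chosen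
    and the representatives are joined into a clique; a single set parameter names them. The sixth
    power appears because a vertex and its successor are at distance at most 3, so two candidates
    for the successor of the same vertex are at distance at most 6 and get different colours.
    Marking each vertex with the colour of its successor therefore singles the successor out. The
    bounded-degree subgraph is grown vertex by vertex. The obstacle is a vertex of full degree at
    the point where the next vertex should be attached. Either its degree can be lowered by
    exchanging edges, or the vertices that resist form a set [S] whose removal leaves more
    components than the linear bound allows. The degree bound is tuned to this count. *)

Section Restriction.
Variable T : finType.
Implicit Types (r : rel T) (S W C : {set T}).

Definition rst r S : rel T := [rel a b | [&& a \in S, b \in S & r a b]].
(** Convertible with [connected_set] when [r] is the adjacency of a graph. The empty set counts as
    connected, so non-emptiness is always stated apart. *)
Definition conn r S := forall x y, x \in S -> y \in S -> connect (rst r S) x y.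
Definition component r W x := [set y | connect (rst r W) x y].
Definition comps r W := [set component r W x | x in W].
(* Twice the number of edges induced on W. *)
Definition E2 r W := \sum_(x in W) \sum_(y in W) (r x y : nat).
Definition deg r W v := #|[set y in W | r v y]|.

Lemma rst_sym r S : symmetric r -> symmetric (rst r S).
Proof. by move=> rs x y; rewrite /rst /= (rs x) andbCA. Qed.

Lemma rst_csym r S : symmetric r -> connect_sym (rst r S).
Proof. by move=> rs; apply: sym_connect_sym; apply: rst_sym. Qed.

Lemma connect_sub_homo r r' S S' x y :
  S \subset S' -> (forall a b, a \in S -> b \in S -> r a b -> r' a b) ->
  connect (rst r S) x y -> connect (rst r' S') x y.
Proof.
move=> sS rr; apply: connect_sub => a b /and3P[aS bS ab]; apply: connect1.
by rewrite /rst /= !(subsetP sS) ?rr.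
Qed.

Lemma connect_subset r S S' x y :
  S \subset S' -> connect (rst r S) x y -> connect (rst r S') x y.
Proof. by move=> sS; apply: connect_sub_homo. Qed.

Lemma connect_invariant r (P : pred T) x y :
  (forall a b, P a -> r a b -> P b) -> P x -> connect r x y -> P y.
Proof.
move=> cl Px /connectP[p]; elim: p x Px => [|z p IH] x Px /= ; first by move=> _ ->.
by case/andP=> xz pz; apply: IH pz; apply: cl xz.
Qed.

Lemma connect_rst_in r W x y : x \in W -> connect (rst r W) x y -> y \in W.
Proof. by apply: connect_invariant => a b _ /and3P[]. Qed.

(** A path that starts in [P] never leaves it, so each of its edges survives the restriction. This
    makes a component connected inside itself. *)
Lemma connect_closed_rst r W (P : pred T) x y :
  (forall a b, P a -> a \in W -> b \in W -> r a b -> P b) -> P x -> x \in W ->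
  connect (rst r W) x y -> connect (rst r (W :&: [set z | P z])) x y.
Proof.
move=> cl Px xW /connectP[p]; elim: p x Px xW => [|z p IH] x Px xW /=.
  by move=> _ ->; apply: connect0.
case/andP=> /and3P[_ zW xz] pz lz; have Pz: P z by apply: cl xz.
apply: connect_trans (IH _ Pz zW pz lz).
by apply: connect1; rewrite /rst /= !inE xW zW Px Pz.
Qed.

Lemma conn_from r W x : symmetric r -> x \in W ->
  (forall y, y \in W -> connect (rst r W) x y) -> conn r W.
Proof.
move=> rs xW H y z yW zW; apply: connect_trans (H _ zW).
by rewrite (rst_csym _ rs) H.
Qed.

Lemma conn1 r x : conn r [set x].
Proof. by move=> y z /set1P-> /set1P->; apply: connect0. Qed.

Lemma conn_setU1 r U v : symmetric r -> conn r U ->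
  (exists2 x, x \in U & r x v) -> conn r (v |: U).
Proof.
move=> rs cU [x xU xv]; apply: (@conn_from _ _ x) => //; first by rewrite inE xU orbT.
move=> y /setU1P[->|yU].
  by apply: connect1; rewrite /rst /= !inE eqxx xU xv orbT.
by apply: connect_subset (cU _ _ xU yU); apply: subsetUr.
Qed.

Lemma comp_refl r W x : x \in component r W x.
Proof. by rewrite inE connect0. Qed.

Lemma comp_sub r W x : x \in W -> component r W x \subset W.
Proof. by move=> xW; apply/subsetP=> y; rewrite inE; apply: connect_rst_in. Qed.

Lemma comp_eq r W x y : symmetric r -> y \in component r W x -> component r W y = component r W x.
Proof.
move=> rs; rewrite inE => xy; apply/setP=> z; rewrite !inE.
by rewrite (same_connect (rst_csym W rs) xy).
Qed.

Lemma comp_closed r W x y z : x \in W -> y \in component r W x -> z \in W -> r y z -> z \in component r W x.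
Proof.
move=> xW; rewrite !inE => xy zW yz; apply: (connect_trans xy); apply: connect1.
by rewrite /rst /= zW yz (connect_rst_in xW xy).
Qed.

Lemma comp_conn r W x : symmetric r -> x \in W -> conn r (component r W x).
Proof.
move=> rs xW; apply: (@conn_from _ _ x) => //; first exact: comp_refl.
move=> y; rewrite inE => xy.
have := @connect_closed_rst r W (mem (component r W x)) x y _ (comp_refl _ _ _) xW xy.
move=> H; apply: (connect_subset _ (H _)); first by apply/subsetP=> z; rewrite !inE => /andP[].
by move=> a b aC aW bW ab; apply: comp_closed ab.
Qed.

Lemma compsP r W C : symmetric r -> C \in comps r W ->
  [/\ C != set0, C \subset W, conn r C &
      forall x y, x \in C -> y \in W -> r x y -> y \in C].
Proof.
move=> rs /imsetP[x xW ->]; split.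
- by apply/set0Pn; exists x; apply: comp_refl.
- exact: comp_sub.
- exact: comp_conn.
- by move=> y z; apply: comp_closed.
Qed.

Lemma comps_disj r W C C' x : symmetric r -> C \in comps r W -> C' \in comps r W ->
  x \in C -> x \in C' -> C = C'.
Proof.
move=> rs /imsetP[y yW ->] /imsetP[z zW ->] xy xz.
by rewrite -(comp_eq rs xy) (comp_eq rs xz).
Qed.

(** Converse of [compsP]: components are recognised without a representative, which allows [r] and
    [W] to change. *)
Lemma closed_comps r W C : symmetric r -> C != set0 -> C \subset W -> conn r C ->
  (forall x y, x \in C -> y \in W -> r x y -> y \in C) -> C \in comps r W.
Proof.
move=> rs /set0Pn[x xC] CW cC cl; apply/imsetP; exists x; first exact: (subsetP CW).
apply/setP=> y; rewrite inE; apply/idP/idP => [yC|].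
  exact: connect_subset (cC _ _ xC yC).
by apply: connect_invariant => // a b aC /and3P[_ bW ab]; apply: cl ab.
Qed.

Lemma comps_mono r r' W : symmetric r' -> subrel r r' -> #|comps r' W| <= #|comps r W|.
Proof.
(* [h] sends an [r]-component to the [r']-component around it, and every [r']-component is
   reached. *)
move=> rs rr; pose h C := [set y | [exists x in C, connect (rst r' W) x y]].
suff: comps r' W \subset h @: comps r W.
  by move/subset_leq_card/leq_trans; apply; apply: leq_imset_card.
apply/subsetP=> C /imsetP[x xW ->]; apply/imsetP; exists (component r W x); first exact: imset_f.
apply/setP=> y; rewrite !inE; apply/idP/existsP.
  by move=> xy; exists x; rewrite comp_refl.
case=> z /andP[]; rewrite inE => xz; apply: connect_trans.
by apply: connect_sub_homo xz => // a b _ _; apply: rr.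
Qed.

Lemma E2_setD1 r W v : symmetric r -> v \in W ->
  E2 r W = r v v + (deg r (W :\ v) v).*2 + E2 r (W :\ v).
Proof.
move=> rs vW; rewrite /E2 (big_setD1 v) //= (big_setD1 v) //=.
under [X in _ + X]eq_bigr => i _ do rewrite (big_setD1 v) //=.
rewrite big_split /= addnA; congr (_ + _); rewrite -addnA; congr (_ + _).
have H : \sum_(i in W :\ v) (r v i : nat) = deg r (W :\ v) v.
  rewrite /deg -sum1_card big_mkcond [RHS]big_mkcond /=; apply: eq_bigr => i _.
  by rewrite !inE; case: (_ && _) => //=; case: (r v i).
rewrite -addnn H; congr (_ + _); rewrite -H; apply: eq_bigr => i _; by rewrite rs.
Qed.

Lemma E2_deg r W : E2 r W = \sum_(x in W) deg r W x.
Proof.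
apply: eq_bigr => x _; rewrite /deg -sum1_card big_mkcond [RHS]big_mkcond /=.
by apply: eq_bigr => i _; rewrite !inE; case: (_ \in _) => //=; case: (r x i).
Qed.

Lemma conn_bigcup r q (J : {set T}) (B : T -> {set T}) :
  conn q J -> (forall i, i \in J -> conn r (B i)) ->
  (forall i j, i \in J -> j \in J -> q i j -> exists x y, [/\ x \in B i, y \in B j & r x y]) ->
  conn r (\bigcup_(i in J) B i).
Proof.
move=> cJ cB adj x y /bigcupP[i iJ xi] /bigcupP[j jJ yj].
have /connectP[p] := cJ _ _ iJ jJ.
have sB k : k \in J -> B k \subset \bigcup_(i in J) B i by move=> kJ; apply: bigcup_sup kJ.
elim: p i x iJ xi => [|k p IH] i x iJ xi /=.
  by move=> _ ji; subst j; apply: connect_subset (cB _ iJ _ _ xi yj); apply: sB.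
case/andP=> /and3P[_ kJ ik] pk lk; have [a [b [ai bk ab]]] := adj _ _ iJ kJ ik.
apply: connect_trans (connect_subset (sB _ iJ) (cB _ iJ _ _ xi ai)) _.
apply: connect_trans (IH _ _ kJ bk pk lk); apply: connect1.
by rewrite /rst /= ab (subsetP (sB _ iJ)) // (subsetP (sB _ kJ)).
Qed.

(* By induction: deleting a vertex of degree d increases the number of components by at most d - 1. *)
Lemma card_comps_E2 r W : symmetric r -> (#|W|).*2 <= (#|comps r W|).*2 + E2 r W.
Proof.
move=> rs; move: {2}#|W| (erefl #|W|) => n; elim: n W => [|n IH] W Wn; first by rewrite Wn.
have [v vW] : exists v, v \in W by apply/set0Pn; rewrite -card_gt0 Wn.
have Wn' : #|W :\ v| = n by move: Wn; rewrite (cardsD1 v) vW => -[].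
have := IH _ Wn'; rewrite Wn (E2_setD1 rs vW).
(* Components of [W :\ v] without a neighbour of [v] remain components of [W], which has that of [v]
   besides; every other one contains a neighbour of [v]. *)
pose A := [set C in comps r (W :\ v) | [disjoint C & [set y in W :\ v | r v y]]].
have cA : #|A| < #|comps r W|.
  rewrite [X in _ < X](cardsD1 (component r W v)) imset_f // add1n ltnS.
  apply: subset_leq_card; apply/subsetP=> C; rewrite inE => /andP[Cc dC].
  have [C0 CW cC cl] := compsP rs Cc; rewrite in_setD1; apply/andP; split.
    apply/eqP=> CE; have := comp_refl r W v; rewrite -CE => /(subsetP CW).
    by rewrite !inE eqxx.
  apply: closed_comps => //; first by apply: subset_trans CW _; apply: subsetDl.
  move=> x y xC yW xy; have [yv|yv] := eqVneq y v; last by apply: (cl x) => //; rewrite !inE yv.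
  have : x \in [set y in W :\ v | r v y] by rewrite inE (subsetP CW) //= rs -yv.
  by move=> H; move: dC; rewrite disjoint_sym => /disjointFr/(_ H); rewrite xC.
have cB : #|comps r (W :\ v) :\: A| <= deg r (W :\ v) v.
  apply: leq_trans (leq_imset_card (component r (W :\ v)) _).
  apply: subset_leq_card; apply/subsetP=> C; rewrite inE => /andP[CA Cc].
  move: CA; rewrite inE Cc /= => /pred0Pn[x /andP[/= xC xN]].
  apply/imsetP; exists x => //; have xW : x \in W :\ v by move: xN; rewrite inE => /andP[].
  apply: (comps_disj rs Cc) xC (comp_refl _ _ _); exact: imset_f.
have cAB : #|comps r (W :\ v)| <= #|A| + #|comps r (W :\ v) :\: A|.
  apply: leq_trans (leq_card_setU _ _); apply: subset_leq_card.
  by apply/subsetP=> C Cc; rewrite in_setU in_setD Cc andbT orbN.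
lia.
Qed.

End Restriction.

(** * Types and exchange of pieces *)

Fixpoint vbound (phi : mso) : nat :=
  match phi with
  | MEq i j | MRel i j | MIn i j => maxn i.+1 j.+1
  | MNot p => vbound p
  | MAnd p q => maxn (vbound p) (vbound q)
  | MEx1 i p | MEx2 i p => maxn i.+1 (vbound p)
  end.

Fixpoint qrank (phi : mso) : nat :=
  match phi with
  | MNot p => qrank p
  | MAnd p q => maxn (qrank p) (qrank q)
  | MEx1 _ p | MEx2 _ p => (qrank p).+1
  | _ => 0
  end.

Definition bitsT (k M : nat) : finType :=
  ({ffun 'I_M -> bool * bool} * {ffun 'I_M * 'I_M -> bool * bool} * {ffun 'I_k * 'I_M -> bool})%type.

(** Hintikka types of rank [q]. The type does not mention the structure, so its cardinality bounds
    the number of types uniformly over all graphs. *)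
Fixpoint typeT (k M q : nat) : finType :=
  if q is q'.+1 then (bitsT k M * {ffun 'I_M -> {set typeT k M q'}})%type else bitsT k M.

(* A structure glued from pieces [pc x = Some i] along the core [pc x = None], where only
   named core elements [cs t] may be related to other pieces. First-order variable [i] is
   stored as the singleton at position [2 i], set variable [X] at position [2 X + 1]. *)
Section Composition.
Variables (A I : finType) (R : rel A) (pc : A -> option I) (k m : nat) (cs : 'I_k -> A).
Local Notation M := m.*2.
Implicit Types (e : nat -> {set A}) (p : option I).

Definition piece p := [set x | pc x == p].

Definition bits0 (f : nat -> {set A}) : bitsT k M :=
  ([ffun i : 'I_M => (f i == set0, #|f i| == 1)],
   [ffun ij : 'I_M * 'I_M => (f ij.1 :&: f ij.2 == set0,
      [exists x in f ij.1, exists y in f ij.2, R x y])],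
   [ffun ti : 'I_k * 'I_M => [exists y in f ti.2, R (cs ti.1) y]]).

Definition bits p e := bits0 (fun i => e i :&: piece p).

(** [X] ranges over all sets, but only its trace on the piece matters, by [eq_tp]. Every position
    can be overwritten because formulas may rebind variables. *)
Fixpoint tp q p e : typeT k M q :=
  match q return typeT k M q with
  | 0 => bits p e
  | q'.+1 => (bits p e, [ffun i : 'I_M => [set tp q' p (upd e i X) | X : {set A}]])
  end.

Lemma eq_bits p e e' : (forall i, i < M -> e i :&: piece p = e' i :&: piece p) ->
  bits p e = bits p e'.
Proof.
move=> E; rewrite /bits /bits0; congr (_, _, _); apply/ffunP.
- by move=> i; rewrite !ffunE E.
- by move=> [i j]; rewrite !ffunE /= !E.
- by move=> [t i]; rewrite !ffunE /= !E.
Qed.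

Lemma eq_tp q p e e' : (forall i, i < M -> e i :&: piece p = e' i :&: piece p) ->
  tp q p e = tp q p e'.
Proof.
elim: q e e' => [|q IH] e e' E /=; first exact: eq_bits.
congr (_, _); first exact: eq_bits.
apply/ffunP=> i; rewrite !ffunE; apply: eq_imset => X; apply: IH => j jM.
by rewrite /upd; case: eqP => // _; apply: E.
Qed.

Lemma tp_bits q p p' e e' : tp q p e = tp q p' e' -> bits p e = bits p' e'.
Proof. by case: q => [|q] //= E; apply: (congr1 fst E). Qed.

Variable s : option I -> option I.
Hypotheses (sK : involutive s) (s0 : s None = None).
Hypothesis Rloc : forall a b, R a b -> pc a = pc b \/ pc a = None /\ exists t, a = cs t.

(** The pieces are permuted by [s] up to types, while the core is matched element by element. *)
Definition sim q e e' := (forall p, tp q p e = tp q (s p) e') /\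
  (forall i, i < M -> e i :&: piece None = e' i :&: piece None).

Lemma sim_sym q e e' : sim q e e' -> sim q e' e.
Proof.
case=> H1 H2; split=> [p|i iM]; last by rewrite H2.
by rewrite H1 sK.
Qed.

Lemma sim_eq q e e' f f' : e =1 f -> e' =1 f' -> sim q e e' -> sim q f f'.
Proof.
move=> E E' [H1 H2]; split=> [p|i iM]; last by rewrite -E -E' H2.
rewrite -(@eq_tp _ _ e) => [|i _]; last by rewrite E.
by rewrite H1; apply: eq_tp => i _; rewrite E'.
Qed.

(** Back and forth: equality of types of rank [q.+1] yields an answer to [X] in each piece
    separately, and the answers are glued. Element moves are moves with singletons, so set moves
    suffice. *)
Lemma sim_extend q e e' i X : sim q.+1 e e' -> i < M ->
  exists X', sim q (upd e i X) (upd e' i X').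
Proof.
move=> [H1 H2] iM.
have [f fP] : exists f : option I -> {set A}, forall p, tp q p (upd e i X) = tp q (s p) (upd e' i (f p)).
  apply: (@fin_all_exists _ _ (fun p X' => tp q p (upd e i X) = tp q (s p) (upd e' i X'))) => p.
  have /ffunP/(_ (Ordinal iM)) := congr1 snd (H1 p); rewrite !ffunE => E.
  have : tp q p (upd e i X) \in [set tp q p (upd e (Ordinal iM) X) | X : {set A}] by apply: imset_f.
  by rewrite E => /imsetP[X' _ ->]; exists X'.
(* The answer [f p] lives on the piece [s p], hence the [s] in the definition; on the core [X] is
   copied. *)
pose X' := [set x | if pc x is None then x \in X else x \in f (s (pc x))].
have X0 : X' :&: piece None = X :&: piece None.
  by apply/setP=> x; rewrite !inE; case: (pc x) => [j|] //=; rewrite !andbF.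
exists X'; split=> [[j|]|l lM].
- rewrite fP; apply: eq_tp => l lM; rewrite /upd; case: eqP => // _.
  have sj : s (Some j) != None by rewrite -s0 (inj_eq (inv_inj sK)).
  apply/setP=> x; rewrite !inE; have [->|] := eqVneq (pc x) (s (Some j)); last by rewrite !andbF.
  by case E: (s (Some j)) sj => [j'|//] _; rewrite -E sK.
- by rewrite s0; apply: eq_tp => l lM; rewrite /upd; case: eqP => // _; apply: H2.
- by rewrite /upd; case: eqP => // _; apply: H2.
Qed.

Definition enc (v1 : nat -> A) (v2 : nat -> {set A}) : nat -> {set A} :=
  fun n => if odd n then v2 n./2 else [set v1 n./2].

Lemma enc1 v1 v2 i : enc v1 v2 i.*2 = [set v1 i].
Proof. by rewrite /enc odd_double doubleK. Qed.

Lemma enc2 v1 v2 X : enc v1 v2 X.*2.+1 = v2 X.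
Proof. by rewrite /enc /= odd_double /= uphalf_double. Qed.

Lemma enc_upd1 v1 v2 i a : upd (enc v1 v2) i.*2 [set a] =1 enc (upd v1 i a) v2.
Proof.
move=> n; rewrite /upd /enc; have [->|ne] := eqVneq n i.*2; first by rewrite odd_double doubleK eqxx.
case: ifP => // od; case: eqP => // E; move: ne; rewrite -E.
by have := odd_double_half n; rewrite od add0n => ->; rewrite eqxx.
Qed.

Lemma enc_upd2 v1 v2 X P : upd (enc v1 v2) X.*2.+1 P =1 enc v1 (upd v2 X P).
Proof.
move=> n; rewrite /upd /enc; have [->|ne] := eqVneq n X.*2.+1.
  by rewrite /= odd_double /= uphalf_double eqxx.
case: ifP => // od; case: eqP => // E; move: ne; rewrite -E.
by have := odd_double_half n; rewrite od add1n => ->; rewrite eqxx.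
Qed.

Lemma sim_meet q e e' i j : sim q e e' -> i < M -> j < M ->
  e i :&: e j != set0 -> e' i :&: e' j != set0.
Proof.
move=> [H _] iM jM /set0Pn[x /setIP[xi xj]].
have /(congr1 (fun t => t.1.2))/ffunP/(_ (Ordinal iM, Ordinal jM)) := tp_bits (H (pc x)).
rewrite !ffunE /= => -[E _].
have : e i :&: piece (pc x) :&: (e j :&: piece (pc x)) == set0 = false.
  by apply/negbTE/set0Pn; exists x; rewrite !inE xi xj eqxx.
rewrite E => /negbT/set0Pn[y]; rewrite !inE => /andP[/andP[yi _] /andP[yj _]].
by apply/set0Pn; exists y; rewrite inE yi.
Qed.

(** A related pair inside one piece is seen by the type of that piece. Otherwise [a] is a named core
    element: it stays fixed, and the type of the piece of [b] records its relation to the sets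
    there. *)
Lemma sim_rel q e e' i j a b : sim q e e' -> i < M -> j < M ->
  a \in e i -> b \in e j -> R a b -> exists a' b', [/\ a' \in e' i, b' \in e' j & R a' b'].
Proof.
move=> [H H0] iM jM ai bj ab; case: (Rloc ab) => [pab|[pa [t at_]]].
  have /(congr1 (fun t => t.1.2))/ffunP/(_ (Ordinal iM, Ordinal jM)) := tp_bits (H (pc a)).
  rewrite !ffunE /= => -[_ E].
  have : [exists x in e i :&: piece (pc a), exists y in e j :&: piece (pc a), R x y].
    apply/existsP; exists a; rewrite !inE ai eqxx /=.
    by apply/existsP; exists b; rewrite !inE bj pab eqxx.
  rewrite E => /existsP[x /andP[/setIP[xi _] /existsP[y /andP[/setIP[yj _] xy]]]].
  by exists x, y.
have /(congr1 (fun t => t.2))/ffunP/(_ (t, Ordinal jM)) := tp_bits (H (pc b)).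
rewrite !ffunE /= => E.
have : [exists y in e j :&: piece (pc b), R (cs t) y].
  by apply/existsP; exists b; rewrite !inE bj eqxx -at_.
rewrite E => /existsP[y /andP[/setIP[yj _] ty]]; exists a, y; split=> //; last by rewrite at_.
by have : a \in e i :&: piece None; [rewrite !inE ai pa|rewrite H0 // => /setIP[]].
Qed.

(** A set is a singleton when it is a singleton on one piece and empty on all others, and types
    record both. Thus the answer to an element is an element. *)
Lemma sim_single q e e' i a : sim q e e' -> i < M -> e i = [set a] -> exists a', e' i = [set a'].
Proof.
move=> [H _] iM ea.
have E p : ((e i :&: piece p == set0) = (e' i :&: piece (s p) == set0)) /\
           ((#|e i :&: piece p| == 1) = (#|e' i :&: piece (s p)| == 1)).
  have /(congr1 (fun t => t.1.1))/ffunP/(_ (Ordinal iM)) := tp_bits (H p).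
  by rewrite !ffunE /= => -[].
have ap : e i :&: piece (pc a) = [set a].
  by rewrite ea; apply/setIidPl; rewrite sub1set inE eqxx.
have [_] := E (pc a); rewrite ap cards1 eqxx => /esym/cards1P[a' ea'].
exists a'; rewrite -ea'; apply/esym/setIidPl; apply/subsetP=> x xi.
rewrite inE; apply/negPn/negP=> np; have [+ _] := E (s (pc x)).
have -> : e i :&: piece (s (pc x)) == set0.
  rewrite ea; apply/eqP/setP=> y; rewrite !inE; apply/negP=> /andP[/eqP-> /eqP pa].
  by rewrite pa sK eqxx in np.
rewrite sK => /esym/eqP/setP/(_ x); by rewrite !inE xi eqxx.
Qed.

(** Equality and membership both say that two encoded sets meet, so [sim_meet] covers both atoms;
    [sim_single] reduces element quantifiers to set moves. *)
Lemma sat_sim phi q v1 v2 v1' v2' : vbound phi <= m -> qrank phi <= q ->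
  sim q (enc v1 v2) (enc v1' v2') -> msat R v1 v2 phi <-> msat R v1' v2' phi.
Proof.
have dbl i : i < m -> i.*2 < M by rewrite ltn_double.
have dbl1 i : i < m -> i.*2.+1 < M by lia.
have meet1 (x : A) (B : {set A}) : ([set x] :&: B != set0) = (x \in B).
  apply/set0Pn/idP=> [[y /setIP[/set1P->]]//|xB].
  by exists x; rewrite !inE eqxx.
elim: phi q v1 v2 v1' v2' => /= [i j|i j|i X|p IH|p IHp r IHr|i p IH|X p IH] q v1 v2 v1' v2'.
- rewrite geq_max => /andP[im jm] _ S.
  suff H u1 u2 u1' u2' : sim q (enc u1 u2) (enc u1' u2') -> u1 i = u1 j -> u1' i = u1' j.
    by split; [apply: H S|apply: H (sim_sym S)].
  move=> {}S E; have := sim_meet S (dbl _ im) (dbl _ jm).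
  by rewrite !enc1 !meet1 !inE E eqxx => /(_ isT)/eqP.
- rewrite geq_max => /andP[im jm] _ S.
  suff H u1 u2 u1' u2' : sim q (enc u1 u2) (enc u1' u2') -> R (u1 i) (u1 j) -> R (u1' i) (u1' j).
    by split; [apply: H S|apply: H (sim_sym S)].
  move=> {}S E; have := @sim_rel q _ _ _ _ (u1 i) (u1 j) S (dbl _ im) (dbl _ jm).
  by rewrite !enc1 !inE !eqxx => /(_ isT isT E)[a' [b' [/set1P-> /set1P->]]].
- rewrite geq_max => /andP[im jm] _ S.
  suff H u1 u2 u1' u2' : sim q (enc u1 u2) (enc u1' u2') -> u1 i \in u2 X -> u1' i \in u2' X.
    by split; [apply: H S|apply: H (sim_sym S)].
  move=> {}S E; have := sim_meet S (dbl _ im) (dbl1 _ jm).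
  by rewrite !enc1 !enc2 !meet1; apply.
- by move=> pm pq S; rewrite (IH _ _ _ _ _ pm pq S).
- rewrite !geq_max => /andP[pm rm] /andP[pq rq] S.
  by rewrite (IHp _ _ _ _ _ pm pq S) (IHr _ _ _ _ _ rm rq S).
- rewrite geq_max => /andP[im pm]; case: q => // q pq S.
  suff H u1 u2 u1' u2' : sim q.+1 (enc u1 u2) (enc u1' u2') ->
      (exists a, msat R (upd u1 i a) u2 p) -> exists a, msat R (upd u1' i a) u2' p.
    by split; [apply: H S|apply: H (sim_sym S)].
  move=> {}S [a sa]; have [X' S'] := sim_extend [set a] S (dbl _ im).
  have [|a' Ea'] := sim_single (a := a) S' (dbl _ im); first by rewrite /upd eqxx.
  rewrite /upd eqxx in Ea'; rewrite Ea' in S'.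
  exists a'; apply/(IH q _ _ _ _ pm pq); last exact: sa.
  by apply: sim_eq (sim_sym S') => n; rewrite enc_upd1.
- rewrite geq_max => /andP[im pm]; case: q => // q pq S.
  suff H u1 u2 u1' u2' : sim q.+1 (enc u1 u2) (enc u1' u2') ->
      (exists a, msat R u1 (upd u2 X a) p) -> exists a, msat R u1' (upd u2' X a) p.
    by split; [apply: H S|apply: H (sim_sym S)].
  move=> {}S [a sa]; have [X' S'] := sim_extend a S (dbl1 _ im).
  exists X'; apply/(IH q _ _ _ _ pm pq); last exact: sa.
  by apply: sim_eq (sim_sym S') => n; rewrite enc_upd2.
Qed.

End Composition.

(* The environments seen inside the piece of x when x is the value of the first-order
   variable 0 only, respectively of all first-order variables but 0. *)
Definition env0 (A : finType) (v2 : nat -> {set A}) x : nat -> {set A} :=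
  fun n => if odd n then v2 n./2 else if n == 0 then [set x] else set0.
Definition env1 (A : finType) (v2 : nat -> {set A}) x : nat -> {set A} :=
  fun n => if odd n then v2 n./2 else if n == 0 then set0 else [set x].

(** The transposition [s] of the two pieces is a similarity. As [env_xy] gives its first element to
    variable 0 and its second to all others, the piece of [a] sees [env0] of [a] under [(a, b)] and
    [env1] of [a] under [(b, a)]; hence one type equality for each role. *)
Lemma swap_pieces (A I : finType) (R : rel A) (pc : A -> option I) (k m q : nat)
    (cs : 'I_k -> A) phi v2 a b i j :
  (forall x y, R x y -> pc x = pc y \/ pc x = None /\ exists t, x = cs t) ->
  vbound phi <= m -> qrank phi <= q -> pc a = Some i -> pc b = Some j -> i != j ->
  tp R pc m cs q (Some i) (env0 v2 a) = tp R pc m cs q (Some j) (env0 v2 b) ->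
  tp R pc m cs q (Some i) (env1 v2 a) = tp R pc m cs q (Some j) (env1 v2 b) ->
  msat R (env_xy a b) v2 phi <-> msat R (env_xy b a) v2 phi.
Proof.
move=> Rloc pm pq pa pb ij E0 E1.
pose s p := if p == Some i then Some j else if p == Some j then Some i else p.
have ijS : Some i != Some j by [].
have sK : involutive s.
  move=> p; rewrite /s; have [->|pi] := eqVneq p (Some i).
    by rewrite eqxx eq_sym (negbTE ijS).
  have [->|pj] := eqVneq p (Some j); first by rewrite eqxx.
  by rewrite (negbTE pi) (negbTE pj).
have s0 : s None = None by [].
have m1 x p : pc x != p -> [set x] :&: piece pc p = set0.
  by move=> np; apply/setP=> y; rewrite !inE; apply/negP=> /andP[/eqP-> /eqP E]; rewrite E eqxx in np.
have half0 n : odd n = false -> (n./2 == 0) = (n == 0).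
  by move=> od; rewrite -[in RHS](odd_double_half n) od add0n double_eq0.
have encE x y p n : odd n = false ->
    enc (env_xy x y) v2 n :&: piece pc p =
    (if n == 0 then [set x] :&: piece pc p else [set y] :&: piece pc p).
  by move=> od; rewrite /enc od /env_xy half0 //; case: (n == 0).
have A0 x y p : pc y != p -> tp R pc m cs q p (enc (env_xy x y) v2) = tp R pc m cs q p (env0 v2 x).
  move=> yp; apply: eq_tp => n _; rewrite /env0; case od: (odd n); first by rewrite /enc od.
  by rewrite encE //; case: eqP => // _; rewrite m1 // set0I.
have A1 x y p : pc x != p -> tp R pc m cs q p (enc (env_xy x y) v2) = tp R pc m cs q p (env1 v2 y).
  move=> xp; apply: eq_tp => n _; rewrite /env1; case od: (odd n); first by rewrite /enc od.
  by rewrite encE //; case: eqP => // _; rewrite m1 // set0I.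
have A2 p n : pc a != p -> pc b != p ->
    enc (env_xy a b) v2 n :&: piece pc p = enc (env_xy b a) v2 n :&: piece pc p.
  move=> ap bp; case od: (odd n); first by rewrite /enc od.
  by rewrite !encE // !m1.
apply: (@sat_sim A I R pc k m cs s sK s0 Rloc phi q) => //; split.
  move=> p; rewrite /s; have [->|pi] := eqVneq p (Some i).
    by rewrite !A0 // ?pa ?pb // eq_sym.
  have [->|pj] := eqVneq p (Some j); first by rewrite !A1 // ?pa ?pb // eq_sym.
  by apply: eq_tp => n _; apply: A2; rewrite ?pa ?pb eq_sym.
by move=> n _; apply: A2; rewrite ?pa ?pb.
Qed.

(** * Components of [G - S] as pieces of the incidence structure *)

Section Separators.
Variables (G : fin_graph) (S : {set 'I_(gn G)}).
Notation V := 'I_(gn G).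
Notation dr := (del_rel S).

(** An edge between [S] and a component belongs to the component, and an edge inside [S] to the
    core. Incidence then crosses pieces only from a vertex of [S]. *)
Definition gpiece (a : inc_univ G) : option V :=
  match a with
  | inl v => if v \in S then None else Some (root dr v)
  | inr d => if (val d).1 \notin S then Some (root dr (val d).1)
             else if (val d).2 \notin S then Some (root dr (val d).2) else None
  end.

Lemma del_rel_csym : connect_sym dr.
Proof. by apply: sym_connect_sym => x y; rewrite /del_rel /= gsym andbCA. Qed.

(** The locality hypothesis of the composition argument. The names enumerate [S] and are padded with
    [x0] up to length [k], so that the types depend on [k] and not on [#|S|]. *)
Lemma gpiece_inc k x0 (a b : inc_univ G) : #|S| <= k -> inc_rel a b ->
  gpiece a = gpiece b \/
  gpiece a = None /\ exists t : 'I_k, a = inl (nth x0 (enum S) t).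
Proof.
move=> Sk; case: a => [v|//]; case: b => [//|d] /=.
have [vS _|vS] := boolP (v \in S).
  right; split=> //.
  have iS : index v (enum S) < #|S| by rewrite cardE index_mem mem_enum.
  by exists (Ordinal (leq_trans iS Sk)); rewrite /= nth_index // mem_enum.
left; case: d H => -[x y] /= /andP[_ xy] /orP[]/eqP E; subst v; first by rewrite vS.
case: ifP => [xS|_]; last by rewrite vS.
congr Some; apply/(rootP del_rel_csym); rewrite del_rel_csym.
by apply: connect1; rewrite /del_rel /= xS vS.
Qed.

Definition proots := [set root dr x | x in ~: S].

Lemma ncomps_proots : ncomps S <= #|proots|.
Proof.
rewrite /ncomps; apply: leq_trans (leq_imset_card (fun x => [set y | connect dr x y]) proots).
apply: subset_leq_card; apply/subsetP=> C /imsetP[x xS ->].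
apply/imsetP; exists (root dr x); first exact: imset_f.
apply/setP=> y; rewrite !inE; apply: (same_connect del_rel_csym); exact: connect_root.
Qed.

Lemma gpiece_root w : w \in proots -> gpiece (inl w) = Some w.
Proof.
case/imsetP=> x xS ->; rewrite /= (root_root del_rel_csym).
suff /negbTE-> : root dr x \notin S by [].
apply: (@connect_invariant _ dr (fun v => v \notin S)) (connect_root dr x).
  by move=> u v _ /and3P[].
by rewrite inE in xS.
Qed.

End Separators.

Lemma orderable_SEP (C : graph_class) : MSO2_orderable C -> has_SEP C.
Proof.
case=> n [phi [_ ord]]; pose T2 k : finType := (typeT k (vbound phi).*2 (qrank phi) * typeT k (vbound phi).*2 (qrank phi))%type.
exists (fun k => #|T2 k|) => G CG k; apply/bigmax_leqP => S Sk.
apply: leq_trans (ncomps_proots S) _; rewrite leqNgt; apply/negP=> big.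
(* [x0] makes the universe non-empty, as the ordering hypothesis requires, and serves as the padding
   name. *)
have /card_gt0P[x0 _] : 0 < #|proots S| by apply: leq_trans big.
have U0 : 0 < #|inc_univ G| by apply/card_gt0P; exists (inl x0).
have [P [_ anti _ total]] := ord G CG U0.
pose cs (t : 'I_k) : inc_univ G := inl (nth x0 (enum S) t).
pose ty w e := tp (@inc_rel G) (@gpiece G S) (vbound phi) cs (qrank phi) (Some w) e.
pose tau w : T2 k := (ty w (env0 (nth set0 P) (inl w)), ty w (env1 (nth set0 P) (inl w))).
have [inj|] := boolP (dinjectiveb tau (proots S)).
  move/dinjectiveP: inj => inj; move: big; rewrite -(card_in_imset inj) ltnNge => /negP; apply.
  exact: max_card.
case/dinjectivePn=> w w1 [w' /andP[/= ne w2] tauE].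
have sw := @swap_pieces _ _ (@inc_rel G) (@gpiece G S) k (vbound phi) (qrank phi) cs phi (nth set0 P)
  (inl w) (inl w') w w' (fun x y => @gpiece_inc G S k x0 x y Sk) (leqnn _) (leqnn _)
  (gpiece_root w1) (gpiece_root w2).
have {sw}sw := sw _ (congr1 fst tauE) (congr1 snd tauE).
have E : inl w = inl w' :> inc_univ G.
  by case: (total (inl w) (inl w')) => H; apply: anti => //; apply/sw => //; rewrite eq_sym.
by case: E ne => ->; rewrite eqxx.
Qed.

(** * Linear separation in graphs without a clique minor *)

Section CliqueMinors.
Variable T : finType.
Implicit Types (r e : rel T) (S W C U K : {set T}).

Definition Kmodel r W h := exists phi : 'I_h -> {set T},
  [/\ forall u, phi u != set0, forall u, phi u \subset W,
      forall u v, u != v -> [disjoint phi u & phi v],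
      forall u, conn r (phi u) &
      forall u v, u != v -> exists x y, [/\ x \in phi u, y \in phi v & r x y]].

Definition nbrs r W U := [set y in W :\: U | [exists x in U, r x y]].

Lemma Kmodel_sub r W W' h : W \subset W' -> Kmodel r W h -> Kmodel r W' h.
Proof.
move=> sW [phi [p0 pW pd pc pa]]; exists phi; split=> // u.
exact: subset_trans (pW u) sW.
Qed.

(** Each vertex of [nbrs r W U] has a neighbour in [U], so [U] is adjacent to all branch sets of the
    model and becomes a new one. *)
Lemma Kmodel_cone r W h U : symmetric r -> U != set0 -> U \subset W -> conn r U ->
  Kmodel r (nbrs r W U) h -> Kmodel r W h.+1.
Proof.
move=> rs U0 UW cU [phi [p0 pW pd pc pa]].
pose psi (i : 'I_h.+1) := if unlift ord0 i is Some j then phi j else U.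
have pU j x : x \in phi j -> (x \in W :\: U) /\ exists2 y, y \in U & r y x.
  by move/(subsetP (pW j)); rewrite inE => /andP[-> /existsP[y /andP[yU yx]]]; split=> //; exists y.
exists psi; split.
- by move=> u; rewrite /psi; case: unlift.
- move=> u; rewrite /psi; case: unlift => // j.
  by apply/subsetP=> x /pU[]; rewrite inE => /andP[].
- have dU j : [disjoint U & phi j].
    rewrite disjoint_sym; apply/pred0P=> x /=; apply/negP=> /andP[/pU[+ _]].
    by rewrite inE => /andP[/negP].
  move=> u v; rewrite /psi; case: unliftP => [i|] ->; case: unliftP => [j|] -> //.
  + by move=> ij; apply: pd; apply: contraNneq ij => ->.
  + by move=> _; rewrite disjoint_sym.
- by move=> u; rewrite /psi; case: unlift.
- have aU j : exists x y, [/\ x \in U, y \in phi j & r x y].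
    have /set0Pn[y yj] := p0 j; have [_ [x xU xy]] := pU _ _ yj.
    by exists x, y.
  move=> u v; rewrite /psi; case: unliftP => [i|] ->; case: unliftP => [j|] -> //.
  + by move=> ij; apply: pa; apply: contraNneq ij => ->.
  + by move=> _; have [x [y [xU yi xy]]] := aU i; exists y, x; rewrite rs.
Qed.

(* Mader's argument: contract a maximal connected set U that keeps the density;
   then every vertex of N(U) has many neighbours inside N(U). *)
Lemma dense_Kmodel r h W : symmetric r -> irreflexive r -> W != set0 ->
  2 ^ h * #|W| <= E2 r W -> Kmodel r W h.
Proof.
move=> rs ri; elim: h W => [|h IHh] W.
  move=> _ _; exists (fun _ => set0); split; by case.
move: {2}#|W|.+1 (ltnSn #|W|) => n; elim: n W => // n IHn W Wn W0 dW.
set d := 2 ^ h.+1 in dW.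
have d0 : 0 < d by rewrite expn_gt0.
(* Contracting [U] leaves [#|W :\: U| + 1] vertices; the last clause says that [d] times this number
   is still at most twice the number of edges. *)
pose ok U := [&& U \subset W, U != set0, [forall x in U, forall y in U, connect (rst r U) x y]
  & d * #|W :\: U| + d <= E2 r (W :\: U) + (#|nbrs r W U|).*2].
have okc U : ok U -> conn r U.
  case/and4P=> _ _ H _ x y xU yU; move/forall_inP: H => /(_ _ xU)/forall_inP/(_ _ yU).
  by [].
have /set0Pn[v vW] := W0.
have ok1 : ok [set v].
  apply/and4P; split; first by rewrite sub1set.
  - by apply/set0Pn; exists v; rewrite inE.
  - by apply/forall_inP=> x xU; apply/forall_inP=> y yU; apply: conn1.
  rewrite -mulnSr; apply: (leq_trans (n := d * #|W|)).
    by rewrite leq_mul2l; apply/orP; right; rewrite (cardsD1 v W) vW.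
  apply: (leq_trans dW); rewrite (E2_setD1 rs vW) ri add0n addnC leq_add2l leq_double.
  apply: subset_leq_card; apply/subsetP=> y; rewrite !inE => /andP[/andP[-> ->] vy] /=.
  by apply/existsP; exists v; rewrite inE eqxx.
case: (arg_maxnP (fun U : {set T} => #|U|) ok1) => U okU maxU.
have cU := okc _ okU; case/and4P: (okU) => UW U0 _ dU.
(* If [U] has no neighbours, the density lies entirely in the smaller set [W :\: U]. *)
have [/eqP N0|Nn] := boolP (nbrs r W U == set0).
  apply: (@Kmodel_sub _ (W :\: U)); first exact: subsetDl.
  rewrite N0 cards0 addn0 in dU.
  apply: IHn.
  - rewrite -ltnS; apply: leq_trans Wn; rewrite ltnS cardsD.
    have : 0 < #|W :&: U| by rewrite (setIidPr UW) card_gt0.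
    by have := subset_leq_card (subsetIl W U); lia.
  - apply/negP=> /eqP E; move: dU; rewrite E cards0 muln0 add0n /E2 big_set0; lia.
  - by apply: leq_trans dU; apply: leq_addr.
apply: (Kmodel_cone rs U0 UW cU); apply: IHh => //.
rewrite E2_deg mulnC -sum_nat_const; apply: leq_sum => u uN.
have [uW uU] : u \in W /\ u \notin U by move: uN; rewrite !inE => /andP[/andP[-> ->]].
have WD : W :\: (u |: U) = (W :\: U) :\ u by apply/setP=> z; rewrite !inE negb_or andbA.
have okN : ~~ ok (u |: U).
  by apply/negP=> /maxU; rewrite cardsU1 uU /= add1n ltnn.
have cU' : conn r (u |: U).
  apply: conn_setU1 => //; move: uN; rewrite inE => /andP[_ /existsP[x /andP[xU xu]]].
  by exists x.
move: okN; rewrite /ok subUset sub1set uW UW /=.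
have -> : u |: U != set0 by apply/set0Pn; exists u; rewrite !inE eqxx.
have -> : [forall x in u |: U, forall y in u |: U, connect (rst r (u |: U)) x y].
  by apply/forall_inP=> x xU; apply/forall_inP=> y yU; apply: cU'.
rewrite /= -ltnNge WD => H.
have uWU : u \in W :\: U by rewrite inE uU.
have WUn : #|W :\: U| = #|(W :\: U) :\ u|.+1 by rewrite (cardsD1 u) uWU.
have EU := E2_setD1 rs uWU; rewrite ri add0n in EU.
(* Contracting [u] into [U] as well loses the edge to [u] and one edge per common neighbour. By
   maximality this destroys the density [d], so twice the loss exceeds [d], and [u] has at least
   [2 ^ h] neighbours in [nbrs r W U]. *)
have NU : #|nbrs r W U| + deg r ((W :\: U) :\ u) u <=
    #|nbrs r W (u |: U)| + 1 + deg r (nbrs r W U) u.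
  rewrite {1}(cardsD1 u) uN add1n addSn addn1 addSn ltnS.
  rewrite /deg -cardsUI; apply: leq_add.
    apply: subset_leq_card; apply/subsetP=> y; rewrite !inE.
    case/orP.
      case/andP=> yu /andP[/andP[yU yW] /existsP[x /andP[xU xy]]].
      rewrite (negbTE yu) yU yW /=; apply/existsP; exists x; by rewrite !inE xU orbT.
    case/andP=> /andP[yu /andP[yU yW]] uy; rewrite (negbTE yu) yU yW /=.
    by apply/existsP; exists u; rewrite !inE eqxx.
  apply: subset_leq_card; apply/subsetP=> y; rewrite !inE.
  by case/andP=> /andP[_ ->] /andP[_ ->].
have dE : d = (2 ^ h).*2 by rewrite /d expnS mul2n.
move: H dU; rewrite WUn EU mulnSr; move: NU; rewrite dE; clear; lia.
Qed.

Definition clique r S K := (K \subset S) && [forall x in K, forall y in K, (x != y) ==> r x y].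

(** Some vertex [v] has degree below [d]. A clique through [v] is fixed by its trace on the
    neighbours of [v], which gives at most [2 ^ d] of them; the others lie in [S :\ v]. The final 1
    is the empty clique. *)
Lemma card_cliques r S d : symmetric r ->
  (forall W, W \subset S -> W != set0 -> E2 r W < d * #|W|) ->
  #|[set K : {set T} | clique r S K]| <= 2 ^ d * #|S| + 1.
Proof.
move=> rs; move: {2}#|S| (erefl #|S|) => n; elim: n S => [|n IH] S Sn H.
  move/eqP: (Sn); rewrite cards_eq0 => /eqP->; rewrite cards0 muln0 add0n -(cards1 (set0 : {set T})).
  apply: subset_leq_card; apply/subsetP=> K; rewrite !inE => /andP[].
  by rewrite subset0.
have S0 : S != set0 by rewrite -card_gt0 Sn.
have [v vS dv] : exists2 v, v \in S & deg r S v < d.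
  apply/exists_inP; case: (boolP [exists x in S, deg r S x < d]) => // nA.
  have A x : x \in S -> d <= deg r S x.
    by move=> xS; rewrite leqNgt; apply: contra nA => dx; apply/exists_inP; exists x.
  exfalso; have := H S (subxx _) S0; rewrite E2_deg ltnNge => /negP; apply.
  by rewrite mulnC -sum_nat_const; apply: leq_sum => x /A.
have Sn' : #|S :\ v| = n by move: Sn; rewrite (cardsD1 v) vS => -[].
have := IH (S :\ v) Sn'; rewrite Sn Sn' => IH'.
apply: (@leq_trans (#|[set K : {set T} | clique r (S :\ v) K]| + 
   #|[set v |: K | K in powerset [set y in S | r v y]]|)).
  apply: leq_trans (leq_card_setU _ _); apply: subset_leq_card; apply/subsetP=> K.
  rewrite !inE => /andP[KS /forall_inP cK].
  have [vK|vK] := boolP (v \in K); apply/orP; [right|left].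
    apply/imsetP; exists (K :\ v); last by rewrite setD1K.
    rewrite inE; apply/subsetP=> y; rewrite !inE => /andP[yv yK].
    rewrite (subsetP KS) //=; move/forall_inP: (cK _ vK) => /(_ _ yK)/implyP; apply.
    by rewrite eq_sym.
  by rewrite /clique subsetD1 KS vK; apply/forall_inP.
have c2 : #|[set v |: K | K in powerset [set y in S | r v y]]| <= 2 ^ d.
  apply: leq_trans (leq_imset_card _ _) _; rewrite card_powerset leq_exp2l //.
  exact: ltnW.
rewrite mulnS; have := IH' _; move=> /(_ _)/leq_add/(_ c2) => H2.
apply: leq_trans (H2 _) _; last lia.
by move=> W WS; apply: H; apply: subset_trans WS _; apply: subsetDl.
Qed.

Lemma clique_Kmodel r W K h : #|K| >= h -> clique r W K -> Kmodel r W h.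
Proof.
move=> hK /andP[KW /forall_inP cK].
case: h hK => [|h] hK; first by exists (fun _ => set0); split; case.
have /card_gt0P[x0 _] : 0 < #|K| by apply: leq_trans hK.
pose f (i : 'I_h.+1) := nth x0 (enum K) i.
have sz (i : 'I_h.+1) : i < size (enum K) by rewrite -cardE; apply: leq_trans hK.
have fK i : f i \in K by rewrite -mem_enum mem_nth.
have fI i j : i != j -> f i != f j.
  by move=> ij; rewrite /f nth_uniq ?enum_uniq.
exists (fun i => [set f i]); split.
- by move=> u; apply/set0Pn; exists (f u); rewrite inE.
- by move=> u; rewrite sub1set (subsetP KW).
- by move=> u v uv; rewrite disjoints1 inE fI.
- by move=> u; apply: conn1.
- move=> u v uv; exists (f u), (f v); rewrite !inE !eqxx; split=> //.
  by move/forall_inP: (cK _ (fK u)) => /(_ _ (fK v))/implyP; apply; apply: fI.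
Qed.


Lemma Kmodel_contract e r S (B : T -> {set T}) h :
  symmetric e -> (forall s, s \in S -> s \in B s) -> (forall s, s \in S -> conn e (B s)) ->
  (forall s t, s \in S -> t \in S -> s != t -> [disjoint B s & B t]) ->
  (forall s t, s \in S -> t \in S -> r s t -> exists x y, [/\ x \in B s, y \in B t & e x y]) ->
  Kmodel r S h -> Kmodel e setT h.
Proof.
move=> es Bs cB dB adj [phi [p0 pS pd pc pa]].
exists (fun u => \bigcup_(s in phi u) B s); split.
- move=> u; have /set0Pn[s su] := p0 u; apply/set0Pn; exists s; apply/bigcupP; exists s => //.
  by apply: Bs; apply: subsetP su.
- by move=> u; apply: subsetT.
- move=> u v uv; apply/pred0P=> x /=; apply/negP=> /andP[/bigcupP[s su xs] /bigcupP[t tv xt]].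
  have st : s != t.
    by apply: contraTneq tv => <-; rewrite (disjointFr (pd _ _ uv) su).
  have := dB _ _ (subsetP (pS u) _ su) (subsetP (pS v) _ tv) st.
  by move/disjointFr/(_ xs); rewrite xt.
- move=> u; apply: (@conn_bigcup _ _ r) => // [i iu|i j iu ju].
    by apply: cB; apply: subsetP iu.
  by apply: adj; apply: (subsetP (pS u)).
- move=> u v uv; have [s [t [su tv st]]] := pa _ _ uv.
  have [x [y [xs yt xy]]] := adj _ _ (subsetP (pS u) _ su) (subsetP (pS v) _ tv) st.
  by exists x, y; split=> //; apply/bigcupP; [exists s|exists t].
Qed.

Definition attach e S C := [set s in S | [exists x in C, e s x]].

(** All components attached exactly to [K] are counted by the components of the graph without [K],
    so a bound for small separators applies to them. *)
Lemma comps_attach e S C : symmetric e -> C \in comps e (~: S) ->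
  C \in comps e (~: attach e S C).
Proof.
move=> es Cc; have [C0 CS cC cl] := compsP es Cc.
apply: closed_comps => //.
  apply/subsetP=> x xC; rewrite !inE negb_and; apply/orP; left.
  by have := subsetP CS _ xC; rewrite inE.
move=> x y xC yK xy; apply: (cl x) => //; rewrite inE.
apply: contraTN yK => yS; rewrite !inE negbK yS; apply/existsP; exists x.
by rewrite xC es.
Qed.

(** * Contracting components into the separator *)

Section Contraction.
Variables (e : rel T) (S : {set T}) (g : {ffun {set T} -> option T}).
Hypotheses (es : symmetric e).

(** [g C = Some s] means that the component [C] is contracted into [s]; components with value [None]
    are left alone. *)
Definition bag s := s |: \bigcup_(C in comps e (~: S) | g C == Some s) C.
Definition contr : rel T := fun s t =>
  [&& s \in S, t \in S, s != t & [exists x in bag s, exists y in bag t, e x y]].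
Definition gdom := [set C | g C != None].
Definition gvalid := [forall C, if g C is Some s then (C \in comps e (~: S)) && (s \in attach e S C) else true].

Lemma contr_sym : symmetric contr.
Proof.
move=> s t; rewrite /contr andbCA eq_sym; do 3 congr (_ && _).
apply/existsP/existsP=> [] [x /andP[xs /existsP[y /andP[yt xy]]]];
  by exists y; rewrite yt; apply/existsP; exists x; rewrite xs es.
Qed.

Lemma contr_irr : irreflexive contr.
Proof. by move=> s; rewrite /contr eqxx !andbF. Qed.

Hypothesis gv : gvalid.

Lemma gvP C s : g C = Some s -> C \in comps e (~: S) /\ s \in attach e S C.
Proof. by move=> gC; move/forallP: gv => /(_ C); rewrite gC => /andP[]. Qed.

Lemma bag_conn s : conn e (bag s).
Proof.
apply: (@conn_from _ _ _ s) => //; first by rewrite !inE eqxx.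
move=> y /setU1P[->|/bigcupP[C /andP[Cc /eqP gC] yC]]; first exact: connect0.
have [_ /[!inE] /andP[_ /existsP[x /andP[xC sx]]]] := gvP gC.
have CB : C \subset bag s.
  by apply: subset_trans (subsetUr _ _); apply: (@bigcup_sup _ _ C); rewrite Cc gC eqxx.
have [_ _ cC _] := compsP es Cc.
apply: connect_trans (connect_subset CB (cC _ _ xC yC)); apply: connect1.
by rewrite /rst /= (subsetP CB _ xC) sx !inE eqxx.
Qed.

Lemma bag_disj s t : s \in S -> t \in S -> s != t -> [disjoint bag s & bag t].
Proof.
move=> sS tS st; apply/pred0P=> x /=; apply/negP=> /andP[].
case/setU1P=> [->|/bigcupP[C /andP[Cc /eqP gC] xC]].
  case/setU1P=> [E|/bigcupP[C /andP[Cc _] sC]]; first by rewrite E eqxx in st.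
  by have [_ /subsetP/(_ _ sC)] := compsP es Cc; rewrite inE sS.
case/setU1P=> [E|/bigcupP[C' /andP[Cc' /eqP gC'] xC']].
  by have [_ /subsetP/(_ _ xC)] := compsP es Cc; rewrite inE E tS.
have E := comps_disj es Cc Cc' xC xC'.
by move: gC; rewrite E gC' => -[E']; rewrite E' eqxx in st.
Qed.

Lemma contr_Kmodel W h : W \subset S -> Kmodel contr W h -> Kmodel e setT h.
Proof.
move=> WS; apply: (Kmodel_contract (B := bag) es).
- by move=> s _; rewrite !inE eqxx.
- by move=> s _; apply: bag_conn.
- by move=> s t /(subsetP WS) sS /(subsetP WS) tS; apply: bag_disj.
- move=> s t _ _ /and4P[_ _ _ /existsP[x /andP[xs /existsP[y /andP[yt xy]]]]].
  by exists x, y.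
Qed.

End Contraction.

Lemma card_gdom_setU1 (g : {ffun {set T} -> option T}) C u :
  g C = None -> #|gdom [ffun D => if D == C then Some u else g D]| = #|gdom g|.+1.
Proof.
move=> gC; have -> : gdom [ffun D => if D == C then Some u else g D] = C |: gdom g.
  by apply/setP=> D; rewrite !inE ffunE; case: (D == C).
by rewrite cardsU1 inE gC.
Qed.

Lemma E2_lt r r' S u v : symmetric r' -> subrel r r' -> u != v -> u \in S -> v \in S ->
  ~~ r u v -> ~~ r v u -> r' u v -> E2 r S + 2 <= E2 r' S.
Proof.
move=> rs rr uv uS vS nuv nvu ruv; rewrite /E2 !pair_big_dep /=.
have vu : (v, u) != (u, v) by rewrite xpair_eqE (negbTE uv) andbF.
rewrite (bigD1 (u, v)) /= ?uS // [X in _ <= X](bigD1 (u, v)) /= ?uS //.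
rewrite (bigD1 (v, u)) /= ?uS ?vS // [X in _ <= _ + X](bigD1 (v, u)) /= ?uS ?vS //.
rewrite (negbTE nuv) (negbTE nvu) (rs v u) ruv !add0n addnA addnC leq_add2l.
by apply: leq_sum => p _; case E: (r _ _) => //; rewrite rr.
Qed.

(** Each contracted component is paid for by an edge, so there are at most [2 ^ h * #|S|]. The
    others are attached to cliques: at most [2 ^ 2 ^ h * #|S| + 1] cliques, each shared by at most
    [F] components. *)
Lemma comps_linear e h F S : symmetric e -> irreflexive e -> ~ Kmodel e setT h ->
  (forall K, #|K| <= h -> #|comps e (~: K)| <= F) ->
  #|comps e (~: S)| <= (2 ^ h + F * 2 ^ (2 ^ h)) * #|S| + F.
Proof.
move=> es ei noK HF.
pose ok g := gvalid e S g && ((#|gdom g|).*2 <= E2 (contr e S g) S).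
have ok0 : ok [ffun _ => None].
  apply/andP; split; first by apply/forallP=> C; rewrite ffunE.
  have -> : gdom [ffun _ => None] = set0 by apply/setP=> C; rewrite !inE ffunE.
  by rewrite cards0.
case: (arg_maxnP (fun g => #|gdom g|) ok0) => g /andP[gv gE] gmax.
set M := contr e S g in gE.
have Ms : symmetric M := contr_sym _ _ es.
have Mi : irreflexive M := @contr_irr _ _ _.
have dens W : W \subset S -> W != set0 -> E2 M W < 2 ^ h * #|W|.
  move=> WS W0; rewrite ltnNge; apply/negP=> H; apply: noK.
  by apply: (contr_Kmodel es gv WS); apply: dense_Kmodel.
have domS : #|gdom g| <= 2 ^ h * #|S|.
  have [S0|S0] := eqVneq S set0.
    by move: gE; rewrite S0 /E2 big_set0; lia.
  by have := dens _ (subxx _) S0; lia.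
have cl C : C \in comps e (~: S) -> g C = None -> clique M S (attach e S C).
  move=> Cc gC; apply/andP; split; first by apply/subsetP=> s; rewrite inE => /andP[].
  apply/forall_inP=> u uC; apply/forall_inP=> v vC; apply/implyP=> uv.
  apply/negPn/negP=> nM.
  (* Were [u] and [v] non-adjacent, contracting [C] into [u] would create the edge [uv] through a
     neighbour of [v] in [C], against maximality of [g]. *)
  pose g' := [ffun D => if D == C then Some u else g D] : {ffun {set T} -> option T}.
  have uS : u \in S by move: uC; rewrite inE => /andP[].
  have vS : v \in S by move: vC; rewrite inE => /andP[].
  have cd : #|gdom g'| = #|gdom g|.+1 by apply: card_gdom_setU1.
  suff : ok g' by move/gmax; rewrite cd /= ltnn.
  apply/andP; split.
    apply/forallP=> D; rewrite ffunE; case: eqP => [->|_]; first by rewrite Cc.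
    by move/forallP: gv => /(_ D).
  have sb s : bag e S g s \subset bag e S g' s.
    apply: setUS; apply/bigcupsP=> D /andP[Dc gD]; apply: (@bigcup_sup _ _ D).
    by rewrite Dc ffunE; case: (eqVneq D C) gD => [->|_ //]; rewrite gC.
  have sM : subrel M (contr e S g').
    move=> s t /and4P[sS tS st /existsP[x /andP[xs /existsP[y /andP[yt xy]]]]].
    apply/and4P; split=> //; apply/existsP; exists x; rewrite (subsetP (sb s)) //.
    by apply/existsP; exists y; rewrite (subsetP (sb t)).
  rewrite cd doubleS; apply: (@leq_trans (E2 M S + 2)); first by rewrite addn2 !ltnS.
  apply: (@E2_lt _ _ _ u v) => //; first exact: contr_sym.
    by rewrite Ms.
  apply/and4P; split=> //; move: vC; rewrite inE => /andP[_ /existsP[x /andP[xC vx]]].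
  apply/existsP; exists x; apply/andP; split.
    apply/setU1P; right; apply/bigcupP; exists C => //.
    by rewrite Cc ffunE eqxx eqxx.
  by apply/existsP; exists v; rewrite es vx !inE eqxx.
pose Q := [set C in comps e (~: S) | g C == None].
have QS : #|comps e (~: S)| <= #|gdom g| + #|Q|.
  apply: leq_trans (leq_card_setU _ _); apply: subset_leq_card; apply/subsetP=> C Cc.
  by rewrite !inE Cc /= orNb.
have QF : #|Q| <= F * #|[set K : {set T} | clique M S K]|.
  rewrite -sum1_card (partition_big (attach e S) (fun K => K \in [set K | clique M S K])) /=; last first.
    by move=> C; rewrite !inE => /andP[Cc /eqP gC]; apply: cl.
  rewrite mulnC -sum_nat_const; apply: leq_sum => K; rewrite inE => cK.
  have Kh : #|K| <= h.
    rewrite leqNgt; apply/negP=> hK; apply: noK; apply: (contr_Kmodel es gv (subxx _)).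
    by apply: clique_Kmodel cK; apply: ltnW.
  apply: leq_trans (HF _ Kh); rewrite sum1_card; apply: subset_leq_card; apply/subsetP=> C.
  by rewrite unfold_in /= inE => /andP[/andP[Cc _] /eqP<-]; apply: comps_attach.
have cc : F * #|[set K | clique M S K]| <= F * (2 ^ 2 ^ h * #|S| + 1).
  by rewrite leq_mul2l (card_cliques Ms dens) orbT.
apply: leq_trans QS _; apply: leq_trans (leq_add domS (leq_trans QF cc)) _.
by rewrite mulnDl mulnDr muln1 mulnA addnA.
Qed.

End CliqueMinors.

(** * Connected spanning subgraphs of bounded degree *)

Section BoundedDegree.
Variables (T : finType) (e : rel T) (D : nat).
Hypothesis es : symmetric e.
Implicit Types (F : {set T * T}) (X S K : {set T}).

Definition fr F : rel T := fun x y => (x, y) \in F.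
Definition fdeg F x := #|[set y | fr F x y]|.

(* F is a set of ordered pairs, so the cardinality condition says at most |X| - 1 edges. *)
Definition tree F X := [/\ symmetric (fr F),
  forall x y, fr F x y -> [/\ e x y, x \in X & y \in X],
  conn (fr F) X, #|F| + 2 <= (#|X|).*2 & forall x, fdeg F x <= D].

Definition agree K F F' := forall x y, ~~ ((x \in K) && (y \in K)) -> fr F' x y = fr F x y.

(* F' lowers the degree of v below D by changing F only inside the component of v in F - S. *)
Definition red F X S v F' := let K := component (fr F) (X :\: S) v in
  [&& [forall x, forall y, fr F' x y == fr F' y x],
      [forall x, forall y, fr F' x y ==> e x y],
      [forall x, forall y, ((x \in K) && (y \in K)) || (fr F' x y == fr F x y)],
      [forall x in K, forall y in K, connect (rst (fr F') K) x y],
      #|F'| <= #|F|, [forall x, fdeg F' x <= D] & fdeg F' v < D].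

Lemma redP F X S v F' : let K := component (fr F) (X :\: S) v in
  reflect ([/\ symmetric (fr F'), subrel (fr F') e, agree K F F', conn (fr F') K &
     [/\ #|F'| <= #|F|, forall x, fdeg F' x <= D & fdeg F' v < D]]) (red F X S v F').
Proof.
move=> K; apply: (iffP idP).
  case/and4P=> /forallP A /forallP B /forallP C /and4P[/forall_inP E c /forallP G d].
  split; last by split.
  - by move=> x y; apply/eqP; move/forallP: (A x); apply.
  - by move=> x y; apply/implyP; move/forallP: (B x); apply.
  - move=> x y /negbTE xy; apply/eqP.
    by move/forallP: (C x) => /(_ y); rewrite -/K xy.
  - by move=> x y xK yK; move/forall_inP: (E _ xK); apply.
case=> A B C E [c G d]; apply/and4P; split; last (apply/and4P; split=> //).
- by apply/forallP=> x; apply/forallP=> y; rewrite A.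
- by apply/forallP=> x; apply/forallP=> y; apply/implyP; apply: B.
- apply/forallP=> x; apply/forallP=> y; case: (boolP (_ && _)) => //= xy.
  by rewrite C.
- by apply/forall_inP=> x xK; apply/forall_inP=> y; apply: E.
- exact/forallP.
Qed.

Definition reducible F X S v := [exists F', red F X S v F'].

(** An edge inside [K] is replaced by a path of the new graph on [K]; all other edges are
    unchanged. *)
Lemma conn_replace F F' K K' : K \subset K' -> agree K F F' -> conn (fr F') K ->
  conn (fr F) K' -> conn (fr F') K'.
Proof.
move=> KK ag cK cK' x y xK yK; apply: connect_sub (cK' _ _ xK yK) => a b /and3P[aK bK ab].
have [/andP[ka kb]|nk] := boolP ((a \in K) && (b \in K)).
  exact: connect_subset (cK _ _ ka kb).
by apply: connect1; rewrite /rst /= aK bK ag.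
Qed.

Lemma card_agree K F F' : agree K F F' ->
  #|F'| + #|F :&: setX K K| = #|F| + #|F' :&: setX K K|.
Proof.
move=> ag; rewrite -(cardsID (setX K K) F') -(cardsID (setX K K) F).
have -> : F' :\: setX K K = F :\: setX K K.
  apply/setP=> -[x y]; rewrite !inE /=; case: (boolP ((x \in K) && (y \in K))) => //= nk.
  exact: (ag x y nk).
by rewrite addnAC [RHS]addnAC; congr (_ + _); apply: addnC.
Qed.

Lemma path_exit (r : rel T) (P : pred T) x p : path r x p -> P x -> ~~ P (last x p) ->
  exists p1 w p2, [/\ p = p1 ++ w :: p2, P (last x p1) & ~~ P w].
Proof.
elim: p x => [|y p IH] x /=; first by move=> _ ->.
case/andP=> xy py Px nP; have [Py|nPy] := boolP (P y); last by exists [::], y, p.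
by have [p1 [w [p2 [-> A B]]]] := IH _ py Py nP; exists (y :: p1), w, p2.
Qed.

Lemma path_connect_in (r r' : rel T) a q : path r a q ->
  (forall b c, b \in a :: q -> c \in a :: q -> r b c -> r' b c) ->
  connect r' a (last a q).
Proof.
elim: q a => [|b q IH] a /=; first by move=> _ _; apply: connect0.
case/andP=> ab pb H; apply: (@connect_trans _ _ b).
  by apply: connect1; apply: H => //; rewrite !inE eqxx ?orbT.
by apply: IH => // c d cq dq; apply: H; rewrite inE ?cq ?dq orbT.
Qed.

(* Adding uv and deleting an edge at an inner vertex w of a u-v path keeps connectivity. *)
Lemma swap_edge F K u v : symmetric (fr F) -> conn (fr F) K -> u \in K -> v \in K -> e u v ->
  (forall x, fdeg F x <= D) -> fdeg F u < D -> fdeg F v < D -> subrel (fr F) e ->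
  forall P : pred T, P u -> ~~ P v ->
  (forall a b, P a -> ~~ P b -> b \in K -> fr F a b -> b != v) ->
  exists a w F', [/\ P a, ~~ P w, fr F a w, w \in K & 
    [/\ symmetric (fr F'), subrel (fr F') e, agree K F F', conn (fr F') K &
     [/\ #|F'| <= #|F|, forall x, fdeg F' x <= D & fdeg F' w < D]]].
Proof.
move=> Fs cF uK vK euv dF du dv Fe P Pu nPv exitv.
have /connectP[p0 pp0 lp0] := cF _ _ uK vK.
have [p [pp up lp]] : exists p, [/\ path (rst (fr F) K) u p, uniq (u :: p) & v = last u p].
  by case/shortenP: pp0 lp0 => p pp up _ lp; exists p; split.
have [p1 [w [p2 [Ep Pl nPw]]]] : exists p1 w p2, [/\ p = p1 ++ w :: p2, P (last u p1) & ~~ P w].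
  by apply: path_exit pp Pu _; rewrite -lp.
have aw : rst (fr F) K (last u p1) w by move: pp; rewrite Ep cat_path => /andP[_ /andP[]].
have [wK faw] : w \in K /\ fr F (last u p1) w by case/and3P: aw.
have wv : w != v by apply: exitv faw.
have wu : w != u by apply: contraNneq nPw => ->.
case: p2 Ep => [|x p3] Ep; first by move: lp wv; rewrite Ep last_cat /= => ->; rewrite eqxx.
have wx : rst (fr F) K w x by move: pp; rewrite Ep cat_path => /andP[_ /and3P[]].
have [xK fwx] : x \in K /\ fr F w x by case/and3P: wx.
have up1 : uniq (rcons (u :: p1) w ++ (x :: p3)) by rewrite cat_rcons cat_cons -Ep.
have xn : x \notin u :: rcons p1 w.
  by move: up1; rewrite cat_uniq => /and3P[_ /hasPn/(_ x) H _]; apply: H; rewrite inE eqxx.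
have wn : w \notin x :: p3.
  move: up1; rewrite cat_uniq => /and3P[_ /hasPn H _].
  by apply/negP=> /H/negP; apply; rewrite mem_rcons inE eqxx.
have xw : x != w by apply: contraNneq wn => <-; rewrite inE eqxx.
(* [x] follows [w] on a simple path, so neither segment left over uses [wx]. The vertex [w] loses an
   edge, while [u] and [v] had room for one. *)
pose F0 := F :\: [set (w, x); (x, w)].
pose F' := F0 :|: [set (u, v); (v, u)].
have F0E a b : (a, b) \in F0 = [&& (a, b) != (w, x), (a, b) != (x, w) & fr F a b].
  by rewrite !inE negb_or andbA.
have F'E a b : fr F' a b = [|| (a, b) \in F0, (a, b) == (u, v) | (a, b) == (v, u)].
  by rewrite /fr [in LHS]inE [in X in _ || X]inE !in_set1.
have F's : symmetric (fr F').
  move=> a b; rewrite !F'E !F0E Fs !xpair_eqE; 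
  rewrite ![(b == _) && _]andbC; case: (fr F b a); rewrite ?andbF ?andbT /=.
    by rewrite [in LHS]andbC; congr (_ || _); rewrite orbC.
  by rewrite orbC.
exists (last u p1), w, F'; split=> //; split=> //.
- move=> a b; rewrite F'E F0E => /or3P[/and3P[_ _]|/eqP[-> ->]|/eqP[-> ->]] //; first exact: Fe.
  by rewrite es.
- move=> a b nk; rewrite F'E F0E !xpair_eqE.
  have H c d : c \in K -> d \in K -> (a == c) && (b == d) = false.
    by move=> cK dK; apply: contraNF nk => /andP[/eqP-> /eqP->]; rewrite cK.
  by rewrite !H //= !orbF.
- have s0 : forall b c, (b, c) \in F0 -> fr F' b c by move=> b c H; rewrite F'E H.
  have c1 : connect (rst (fr F') K) u w.
    have -> : w = last u (rcons p1 w) by rewrite last_rcons.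
    apply: (@path_connect_in (rst (fr F) K)).
      by move: pp; rewrite Ep -cat_rcons cat_path => /andP[].
    move=> b c bq cq /and3P[bK cK bc]; rewrite /rst /= bK cK s0 // F0E bc !xpair_eqE !andbT.
    have nb : b != x by apply: contraNneq xn => <-.
    have nc : c != x by apply: contraNneq xn => <-.
    by rewrite (negbTE nb) (negbTE nc) andbF.
  have c2 : connect (rst (fr F') K) x v.
    have -> : v = last x p3 by rewrite lp Ep last_cat.
    apply: (@path_connect_in (rst (fr F) K)).
      by move: pp; rewrite Ep cat_path => /andP[_ /and3P[]].
    move=> b c bq cq /and3P[bK cK bc]; rewrite /rst /= bK cK s0 // F0E bc !xpair_eqE !andbT.
    have nb : b != w by apply: contraNneq wn => <-.
    have nc : c != w by apply: contraNneq wn => <-.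
    by rewrite (negbTE nb) (negbTE nc) andbF.
  have cs := rst_csym K F's.
  have c3 : connect (rst (fr F') K) w x.
    rewrite cs in c1; apply: connect_trans c1 _; rewrite cs in c2; apply: connect_trans c2.
    by apply: connect1; rewrite /rst /= uK vK F'E eqxx orbT.
  move=> a b aK bK; apply: connect_sub (cF _ _ aK bK) => c d /and3P[cK dK cd].
  have [/eqP[-> ->]//|n1] := boolP ((c, d) == (w, x)).
  have [/eqP[-> ->]|n2] := boolP ((c, d) == (x, w)); first by rewrite cs.
  by apply: connect1; rewrite /rst /= cK dK s0 // F0E n1 n2 cd.
split.
- have c2 : #|[set (w, x); (x, w)]| = 2 by rewrite cards2 xpair_eqE eq_sym (negbTE xw).
  have sF : [set (w, x); (x, w)] \subset F.
    by apply/subsetP=> q; rewrite !inE => /orP[]/eqP->; [exact: fwx|rewrite -/(fr F x w) Fs].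
  have c0 : #|F0| + 2 = #|F| by rewrite /F0 cardsD (setIidPr sF) c2 subnK // -c2 subset_leq_card.
  apply: leq_trans (leq_card_setU _ _) _; rewrite -c0 leq_add2l cards2; by case: eqP.
- have d0 y : fdeg F0 y <= fdeg F y.
    by apply: subset_leq_card; apply/subsetP=> z; rewrite !inE /fr inE => /andP[].
  move=> y; have [->|yu] := eqVneq y u; [|have [->|yv] := eqVneq y v].
  + apply: leq_trans du; rewrite -addn1; apply: (@leq_trans (#|v |: [set z | (u, z) \in F0]|)).
      apply: subset_leq_card; apply/subsetP=> z; rewrite inE F'E in_setU1 inE !xpair_eqE.
      rewrite eqxx /=; case/or3P=> [->|->|/andP[/eqP<- ->]] //; by rewrite orbT.
    by rewrite cardsU1 addnC; apply: leq_add; [apply: d0|case: (_ \notin _)].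
  + apply: leq_trans dv; rewrite -addn1; apply: (@leq_trans (#|u |: [set z | (v, z) \in F0]|)).
      apply: subset_leq_card; apply/subsetP=> z; rewrite inE F'E in_setU1 inE !xpair_eqE.
      rewrite eqxx /=; case/or3P=> [->|/andP[/eqP<- ->]|->] //; by rewrite orbT.
    by rewrite cardsU1 addnC; apply: leq_add; [apply: d0|case: (_ \notin _)].
  + apply: leq_trans (dF y); apply: leq_trans (d0 y); apply: subset_leq_card; apply/subsetP=> z.
    by rewrite !inE F'E !xpair_eqE (negbTE yu) (negbTE yv) !orbF.
- apply: leq_trans (dF w); apply: proper_card; apply/properP; split.
    apply/subsetP=> z; rewrite !inE F'E !xpair_eqE (negbTE wu) (negbTE wv) !orbF F0E.
    by case/and3P.
  exists x; first by rewrite inE.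
  by rewrite inE F'E !xpair_eqE (negbTE wu) (negbTE wv) !orbF F0E eqxx.
Qed.


(** Once every vertex of [X :\: S] is reducible, the last clause says that no edge of [e] joins
    different components of [F - S]. *)
Definition blocking F X S := [/\ S \subset X, forall v, v \in S -> fdeg F v = D &
  forall u v, u \in X :\: S -> v \in X :\: S -> reducible F X S u -> reducible F X S v ->
    v \notin component (fr F) (X :\: S) u -> ~~ e u v].

Lemma tree_red F X S v F' : tree F X -> v \in X :\: S -> red F X S v F' -> tree F' X.
Proof.
case=> Fs Fe cF nF dF vX /redP[F's F'e ag cK [nF' dF' _]].
have KX : component (fr F) (X :\: S) v \subset X.
  by apply: subset_trans (comp_sub _ vX) _; apply: subsetDl.
split=> //.
- move=> x y xy; split; first exact: F'e.
    have [/andP[xK _]|nk] := boolP ((x \in component (fr F) (X :\: S) v) && (y \in component (fr F) (X :\: S) v)).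
      exact: (subsetP KX).
    by move: xy; rewrite ag // => /Fe[].
  have [/andP[_ yK]|nk] := boolP ((x \in component (fr F) (X :\: S) v) && (y \in component (fr F) (X :\: S) v)).
    exact: (subsetP KX).
  by move: xy; rewrite ag // => /Fe[].
- exact: conn_replace KX ag cK cF.
- by apply: leq_trans nF; rewrite leq_add2r.
Qed.

(** A larger [S] gives smaller components, so the same change of [F] stays inside the component for
    the smaller [S]. *)
Lemma reducible_mono F X S S' v : symmetric (fr F) -> S \subset S' -> v \in X :\: S' ->
  reducible F X S' v -> reducible F X S v.
Proof.
move=> Fs SS vX /existsP[F' /redP[F's F'e ag cK [nF' dF' dv]]].
have XX : X :\: S' \subset X :\: S by apply: setDS.
have KK : component (fr F) (X :\: S') v \subset component (fr F) (X :\: S) v.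
  by apply/subsetP=> y; rewrite !inE; apply: connect_subset.
apply/existsP; exists F'; apply/redP; split=> //.
- move=> x y nk; apply: ag; apply: contra nk => /andP[xK yK].
  by rewrite !(subsetP KK).
- apply: conn_replace KK ag cK _; apply: comp_conn => //.
  exact: (subsetP XX).
Qed.

Definition step F X S := S :|: [set v in X :\: S | ~~ reducible F X S v].

(* An edge uv joining two components of F - S' inside one component of F - S would, after
   lowering the degrees of u and v, be exchanged for an edge at some w in S' \ S, so w would be
   reducible. *)
Lemma step_blocking F X S : tree F X -> blocking F X S -> blocking F X (step F X S).
Proof.
move=> tF [SX dS nS]; case: (tF) => Fs Fe cF nF dF; set S' := step F X S.
have SS : S \subset S' by apply: subsetUl.
have XX : X :\: S' \subset X :\: S by apply: setDS.
split.
- by rewrite subUset SX; apply/subsetP=> v; rewrite inE => /andP[/setDP[]].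
- move=> v /setUP[/dS //|]; rewrite inE => /andP[vX nr].
  apply/eqP; rewrite eqn_leq dF leqNgt; apply: contra nr => dv.
  apply/existsP; exists F; apply/redP; split=> //; first by move=> x y /Fe[].
  exact: comp_conn.
move=> u v uX vX ru rv nuv; apply/negP=> euv.
have uX' := subsetP XX _ uX; have vX' := subsetP XX _ vX.
have [vK|nvK] := boolP (v \in component (fr F) (X :\: S) u); last first.
  have ru' := reducible_mono Fs SS uX ru; have rv' := reducible_mono Fs SS vX rv.
  by have := nS _ _ uX' vX' ru' rv' nvK; rewrite euv.
move: ru rv => /existsP[Fu /redP[Fus Fue agu cu [nu du duu]]].
move=> /existsP[Fv /redP[Fvs Fve agv cv [nv dv dvv]]].
set Ku := component (fr F) (X :\: S') u in nuv agu cu.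
set Kv := component (fr F) (X :\: S') v in agv cv.
set K := component (fr F) (X :\: S) u in vK.
have KuK : Ku \subset K by apply/subsetP=> y; rewrite !inE; apply: connect_subset.
have KvK : Kv \subset K.
  apply/subsetP=> y yv; rewrite /K -(comp_eq Fs vK); move: yv; rewrite !inE.
  exact: connect_subset.
have uKu : u \in Ku := comp_refl _ _ _.
have vKv : v \in Kv := comp_refl _ _ _.
have dK x : x \in Ku -> x \notin Kv.
  move=> xu; apply: contraNN nuv => xv; rewrite /Ku -(comp_eq Fs xu) (comp_eq Fs xv).
  exact: comp_refl.
(* Both reductions at once: [Ku] and [Kv] are disjoint, so [Fv] can be pasted over [Fu] on [Kv], and
   both [u] and [v] get spare degree. *)
pose F1 := [set p | if (p.1 \in Kv) && (p.2 \in Kv) then p \in Fv else p \in Fu].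
have F1E x y : fr F1 x y = if (x \in Kv) && (y \in Kv) then fr Fv x y else fr Fu x y.
  by rewrite /fr inE.
have F1s : symmetric (fr F1) by move=> x y; rewrite !F1E andbC Fvs Fus.
have F1e : subrel (fr F1) e by move=> x y; rewrite F1E; case: ifP => _; [apply: Fve|apply: Fue].
have cK : conn (fr F) K by apply: comp_conn.
have ag1 : agree Kv Fu F1 by move=> x y /negbTE nk; rewrite F1E nk.
have c1v : conn (fr F1) Kv.
  move=> x y xK yK; apply: connect_sub_homo (cv _ _ xK yK) => // a b aK bK ab.
  by rewrite F1E aK bK.
have c1 : conn (fr F1) K.
  apply: conn_replace KvK ag1 c1v _; exact: conn_replace KuK agu cu cK.
have row1 x : x \notin Kv -> fdeg F1 x = fdeg Fu x.
  by move=> /negbTE nx; apply: eq_card => y; rewrite !inE F1E nx.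
have row2 x : x \in Kv -> fdeg F1 x = fdeg Fv x.
  move=> xK; apply: eq_card => y; rewrite !inE F1E xK /=; case: ifP => // /negbT yK.
  rewrite agv; last by rewrite xK.
  by rewrite agu //; apply/negP=> /andP[/dK]; rewrite xK.
have n1 : #|F1| <= #|F|.
  apply: leq_trans nu; have E1 := card_agree ag1; have E2' := card_agree agv.
  have A : F1 :&: setX Kv Kv = Fv :&: setX Kv Kv.
    by apply/setP=> -[x y]; rewrite !inE /=; case: ifP => _; rewrite ?andbF.
  have B : Fu :&: setX Kv Kv = F :&: setX Kv Kv.
    apply/setP=> -[x y]; rewrite !in_setI in_setX /=.
    case: (boolP ((x \in Kv) && (y \in Kv))) => [/andP[xK yK]|]; rewrite ?andbF //.
    by rewrite !andbT; apply: agu; apply/negP=> /andP[/dK]; rewrite xK.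
  rewrite A B in E1; rewrite -(leq_add2r #|F :&: setX Kv Kv|) E1 leq_add2l.
  by rewrite -(leq_add2l #|F|) -E2' leq_add2r.
have d1 x : fdeg F1 x <= D.
  by have [xK|xK] := boolP (x \in Kv); [rewrite row2|rewrite row1].
(* [Ku] is a component of [F - S'], hence an edge leaving it inside [K] ends in [S']; this places
   the vertex [w] of the exchange in [S']. *)
have exitw a b : a \in Ku -> b \notin Ku -> b \in K -> fr F1 a b -> b \in S'.
  move=> aK bK bK' ab; have aKv := dK _ aK.
  have abF : fr F a b.
    by move: ab; rewrite F1E (negbTE aKv) /= agu //; apply: contra bK => /andP[].
  have [_ _ bX] := Fe _ _ abF.
  apply: contraNT bK => bS; apply: (comp_closed uX aK _ abF); exact/setDP.
have uKv : u \notin Kv := dK _ uKu.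
have := @swap_edge F1 K u v F1s c1 (subsetP KuK _ uKu) vK euv d1 _ _ F1e (mem Ku) uKu nuv.
rewrite row1 // row2 // => /(_ duu dvv) [].
  move=> a b aK bK bK' ab; have := exitw _ _ aK bK bK' ab.
  by apply: contraTneq => ->; move: vX; rewrite inE => /andP[].
move=> a [w [F2 [aK wK aw wK' [F2s F2e ag2 c2 [n2 d2 dw]]]]].
have wS' := exitw _ _ aK wK wK' aw.
have wX : w \in X :\: S by apply: subsetP wK'; apply: comp_sub.
have : w \in [set v in X :\: S | ~~ reducible F X S v].
  move: wS' wX; rewrite /S' /step in_setU in_setD => /orP[->//|->]; by [].
rewrite inE wX /= => /negP; apply; apply/existsP; exists F2; apply/redP.
rewrite (comp_eq Fs wK'); split=> //.
  move=> x y nk; rewrite ag2 // F1E.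
  have -> : (x \in Kv) && (y \in Kv) = false.
    by apply: contraNF nk => /andP[xK yK]; rewrite !(subsetP KvK).
  by rewrite agu //; apply: contra nk => /andP[xK yK]; rewrite !(subsetP KuK).
by split=> //; apply: leq_trans n1.
Qed.

(** [step] strictly enlarges [S] inside [X] as long as an irreducible vertex is left outside. The
    empty set is a valid start because [F] is connected on [X]. *)
Lemma exists_blocking F X : tree F X -> exists S, blocking F X S /\
  forall v, v \in X :\: S -> reducible F X S v.
Proof.
move=> tF.
have B0 : blocking F X set0.
  split; [exact: sub0set|by move=> v; rewrite inE|].
  case: tF => _ _ cF _ _ u v; rewrite setD0 => uX vX _ _.
  by rewrite inE cF.
move: {2}(#|X| - #|set0 : {set T}|).+1 (ltnSn (#|X| - #|set0 : {set T}|)) B0 => n.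
elim: n (set0 : {set T}) => // n IH S nS BS.
have [A|A] := boolP [forall v in X :\: S, reducible F X S v].
  by exists S; split=> //; apply/forall_inP.
have BS' := step_blocking tF BS; apply: IH BS'.
have [v vX rv] : exists2 v, v \in X :\: S & ~~ reducible F X S v.
  by apply/exists_inP; rewrite -negb_forall_in.
have : #|S| < #|step F X S|.
  apply: proper_card; apply/properP; split; first exact: subsetUl.
  by exists v; [rewrite in_setU inE vX rv orbT|case/setDP: vX].
have : #|step F X S| <= #|X| by case: (step_blocking tF BS) => /subset_leq_card.
move: nS; clear; lia.
Qed.

Lemma card_fdeg F : #|F| = \sum_x fdeg F x.
Proof.
rewrite -sum1_card (eq_bigr (fun p => 1)) //.
under [RHS]eq_bigr => x _ do rewrite /fdeg -sum1_card.
rewrite pair_big_dep /=; apply: eq_bigl => -[x y]; by rewrite inE.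
Qed.

(** The ordered pairs that start in [S] number [D * #|S|]; those inside [X :\: S] start
    elsewhere. *)
Lemma E2_fr F X S : S \subset X -> (forall v, v \in S -> fdeg F v = D) ->
  E2 (fr F) (X :\: S) + D * #|S| <= #|F|.
Proof.
move=> SX dS; rewrite E2_deg card_fdeg [X in _ <= X](bigID (mem S)) /= [X in _ <= X]addnC; apply: leq_add; last first.
  by rewrite mulnC -sum_nat_const; apply: leq_sum => v /dS->.
rewrite big_mkcond [X in _ <= X]big_mkcond /=; apply: leq_sum => v _.
rewrite in_setD; case: (v \in S) => //=; case: (v \in X) => //.
by apply: subset_leq_card; apply/subsetP=> y; rewrite !inE => /andP[].
Qed.

Variables a b : nat.
Hypothesis sep : forall S, #|comps e (~: S)| <= a * #|S| + b.
Hypothesis ce : forall x y, connect e x y.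
Hypothesis DE : D = (a + b + 1).*2.

(** If some [u] in [X :\: S] has a neighbour outside [X], a reduction at [u] makes room for the new
    edge. Otherwise the components of [F - S] are components of [e - S] that miss [z], fewer than
    [a * #|S| + b]. But [F] has at most [#|X| - 1] edges, and the degrees [D] on [S] use up so many
    that at least [(D / 2 - 1) * #|S| + 1] components remain, which is [(a + b) * #|S| + 1]. *)
Lemma tree_extend F X : tree F X -> X != set0 -> X != setT ->
  exists z F', z \notin X /\ tree F' (z |: X).
Proof.
move=> tF X0 XT; have [S [[SX dS nS] rS]] := exists_blocking tF.
case: (tF) => Fs Fe cF nF dF.
have [/existsP[u /andP[uX /existsP[z /andP[zX uz]]]]|nout] :=
  boolP [exists u in X :\: S, exists z in ~: X, e u z].
  have /existsP[Fu ru] := rS _ uX; have [Fus Fue cu nu du] := tree_red tF uX ru.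
  have duu : fdeg Fu u < D by case/redP: ru => _ _ _ _ [].
  rewrite inE in zX; have {}uX : u \in X by case/setDP: uX.
  pose F' := Fu :|: [set (u, z); (z, u)].
  have F'E x y : fr F' x y = [|| fr Fu x y, (x, y) == (u, z) | (x, y) == (z, u)].
    by rewrite /fr [in LHS]inE [in X in _ || X]inE !in_set1.
  have F's : symmetric (fr F').
    move=> x y; rewrite !F'E Fus; congr (_ || _); rewrite orbC !xpair_eqE.
    by congr (_ || _); rewrite andbC.
  exists z, F'; split=> //; split=> //.
  - move=> x y; rewrite F'E => /or3P[/Fue[xy xX yX]|/eqP[-> ->]|/eqP[-> ->]].
    + by rewrite !inE xX yX !orbT.
    + by rewrite !inE uX eqxx orbT.
    + by rewrite !inE uX eqxx orbT es.
  - apply: conn_setU1 => //; last by exists u => //; rewrite F'E eqxx orbT.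
    move=> x y xX yX; apply: connect_sub_homo (cu _ _ xX yX) => // c d _ _ cd.
    by rewrite F'E cd.
  - rewrite cardsU1 zX doubleD /= -[1.*2]/2 addnC leq_add2l.
    apply: leq_trans nu; apply: leq_trans (leq_card_setU _ _) _; rewrite leq_add2l cards2.
    by case: eqP.
  - move=> x; have [->|xu] := eqVneq x u; [|have [->|xz] := eqVneq x z].
    + apply: leq_trans duu; rewrite -addn1.
      apply: (@leq_trans (#|z |: [set y | fr Fu u y]|)).
        apply: subset_leq_card; apply/subsetP=> y; rewrite inE F'E in_setU1 inE !xpair_eqE.
        rewrite eqxx /=; case/or3P=> [->|->|/andP[/eqP<- ->]] //; by rewrite orbT.
      by rewrite cardsU1 addnC; apply: leq_add => //; case: (_ \notin _).
    + apply: (@leq_trans 1); last by rewrite DE; clear; lia.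
      rewrite -(cards1 u); apply: subset_leq_card; apply/subsetP=> y; rewrite inE F'E.
      case/or3P=> [/Fue[_ zX' _]|/eqP[E _]|/eqP[->]]; last by rewrite inE.
        by rewrite zX' in zX.
      by rewrite E uX in zX.
    + apply: leq_trans (du x); apply: subset_leq_card; apply/subsetP=> y.
      by rewrite !inE F'E !xpair_eqE (negbTE xu) (negbTE xz) !orbF.
exfalso.
have out u z : u \in X :\: S -> z \notin X -> ~~ e u z.
  move=> uX zX; apply: contra nout => uz; apply/existsP; exists u; rewrite uX.
  by apply/existsP; exists z; rewrite inE zX.
have /set0Pn[x0 x0X] := X0.
have [z zX] : exists z, z \notin X.
  by apply/existsP; rewrite -negb_forall; apply: contra XT => /forallP A; apply/eqP/setP=> y; rewrite inE A.
(* With [S] empty no edge would leave [X], although [e] is connected. This lets [b] be absorbed into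
   [b * #|S|]. *)
have S0 : 0 < #|S|.
  rewrite card_gt0; apply: contraNneq zX => S0; have cz := ce x0 z.
  apply: (@connect_invariant T e (fun y => y \in X) x0 z _ x0X cz) => c d cX cd; apply: contraTT cd => dX; apply: out => //.
  by rewrite S0 setD0.
have sub : comps (fr F) (X :\: S) \subset comps e (~: S) :\ component e (~: S) z.
  apply/subsetP=> C Cc; have [C0 CX cC cl] := compsP Fs Cc.
  rewrite in_setD1; apply/andP; split.
    apply: contraNneq zX => E; have : z \in C by rewrite E comp_refl.
    by move/(subsetP CX)/setDP=> [].
  apply: closed_comps => //.
  - by apply/subsetP=> y /(subsetP CX); rewrite !inE => /andP[].
  - move=> x y xC yC; apply: connect_sub_homo (cC _ _ xC yC) => // c d _ _ /Fe[] //.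
  move=> x y xC; rewrite inE => yS xy; have xX := subsetP CX _ xC.
  have yX : y \in X by apply: contraTT xy => yX; apply: out.
  have yXS : y \in X :\: S by apply/setDP.
  apply: contraTT xy => yC; apply: nS => //; try exact: rS.
  case/imsetP: Cc => x1 x1X EC; rewrite EC in xC yC.
  by rewrite (comp_eq Fs xC).
have zS : z \in ~: S by rewrite inE; apply: contra zX; apply: (subsetP SX).
have cz : component e (~: S) z \in comps e (~: S) by apply: imset_f.
have c1 := subset_leq_card sub.
have c2 := sep S; rewrite (cardsD1 (component e (~: S) z)) cz in c2.
have c3 := card_comps_E2 (X :\: S) Fs.
have c4 := E2_fr SX dS.
have c5 : #|X :\: S| + #|S| = #|X| by rewrite -(cardsID S X) (setIidPr SX) addnC.
have c6 : b <= b * #|S| by rewrite leq_pmulr.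
have c7 : D * #|S| = (a * #|S| + b * #|S| + #|S|).*2 by rewrite DE -doubleMl !mulnDl mul1n.
move: c1 c2 c3 c4 c5 c6 c7 nF.
move: #|comps (fr F) (X :\: S)| #|comps e (~: S) :\ _| (#|S|) #|X :\: S| (E2 _ _) (#|F|) (#|X|) (D * _) (a * _) (b * _).
clear; move=> /= *; lia.
Qed.

Lemma bounded_degree_spanning : 0 < #|T| -> exists F, [/\ symmetric (fr F), subrel (fr F) e,
   forall x y, connect (fr F) x y & forall x, fdeg F x <= D].
Proof.
move=> T0; have /card_gt0P[x0 _] := T0.
suff : forall n, n < #|T| -> exists F X, #|X| = n.+1 /\ tree F X.
  move=> /(_ #|T|.-1) []; first by rewrite prednK.
  move=> F [X [cX [Fs Fe cF nF dF]]].
  have XT : X = setT.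
    by apply/eqP; rewrite eqEcard subsetT /= cardsT cX prednK.
  exists F; split=> // [x y /Fe[]//|x y].
  by have := cF x y; rewrite XT !inE => /(_ isT isT); apply: connect_sub => c d /and3P[_ _ cd]; apply: connect1.
elim=> [|n IH] nT.
  exists set0, [set x0]; rewrite cards1; split=> //; split.
  - by move=> x y; rewrite /fr !inE.
  - by move=> x y; rewrite /fr in_set0.
  - exact: conn1.
  - by rewrite cards0 cards1.
  - move=> x; rewrite /fdeg (_ : [set y | _] = set0) ?cards0 //.
    by apply/setP=> y; rewrite !inE /fr inE.
have [F [X [cX tF]]] := IH (ltnW nT).
have X0 : X != set0 by rewrite -card_gt0 cX.
have XT : X != setT by apply: contraTneq nT => E; move: cX; rewrite E cardsT => ->; rewrite ltnn.
have [z [F' [zX tF']]] := tree_extend tF X0 XT.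
by exists F', (z |: X); rewrite cardsU1 zX cX.
Qed.

End BoundedDegree.

(** * Hamiltonian paths in the cube *)

Section CubeOrder.
Variables (T : finType) (r : rel T).
Hypotheses (rs : symmetric r) (rr : reflexive r).

(** As [r] is reflexive, [cube] means distance at most 3 and [meet3] distance at most 6. *)
Definition cube : rel T := fun x y => [exists a, exists b, [&& r x a, r a b & r b y]].
Definition meet3 : rel T := fun x y => [exists z, cube z x && cube z y].

Lemma cube_sym : symmetric cube.
Proof.
by move=> x y; apply/existsP/existsP=> [] [a /existsP[b /and3P[xa ab byy]]];
  exists b; apply/existsP; exists a; rewrite rs byy rs ab rs xa.
Qed.

(* Sekanina's theorem: split off the component of a neighbour of x and traverse it backwards. *)
Lemma cube_enum (X : {set T}) x : x \in X -> conn r X -> exists p,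
  [/\ path cube x p, uniq (x :: p), x :: p =i X & r x (last x p)].
Proof.
move: {2}#|X|.+1 (ltnSn #|X|) => n; elim: n X x => // n IH X x Xn xX cX.
have [X1|/set0Pn[y' y'X]] := eqVneq (X :\ x) set0.
  exists [::]; split=> //.
  by move=> y; rewrite -(setD1K xX) X1 setU0 !inE.
have [y'x {}y'X] : y' != x /\ y' \in X by move: y'X; rewrite !inE => /andP.
have /connectP[p pp lp] := cX _ _ xX y'X.
have [p1 [y [p2 [Ep /eqP lx yx]]]] : exists p1 w p2, [/\ p = p1 ++ w :: p2, pred1 x (last x p1) & ~~ pred1 x w].
  by apply: path_exit pp _ _; rewrite /= ?eqxx // -lp.
have [yX rxy] : y \in X /\ r x y.
  by move: pp; rewrite Ep cat_path lx => /andP[_ /andP[/and3P[_ -> ->] _]].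
have yXx : y \in X :\ x by rewrite !inE yx.
set X2 := component r (X :\ x) y; have yX2 : y \in X2 := comp_refl _ _ _.
have X2X : X2 \subset X :\ x := comp_sub _ yXx.
have xX2 : x \notin X2 by apply/negP=> /(subsetP X2X); rewrite !inE eqxx.
have xX1 : x \in X :\: X2 by rewrite inE xX2.
have cX2 : conn r X2 by apply: comp_conn.
(* The other components of [X :\ x] are each linked to [x], by the first exit of a path towards
   [x]. *)
have cX1 : conn r (X :\: X2).
  apply: (conn_from rs xX1) => z zX1; rewrite (rst_csym _ rs).
  have [->|zx] := eqVneq z x; first exact: connect0.
  have /setDP[zX zX2] := zX1; have zXx : z \in X :\ x by rewrite !inE zx.
  have CzX : component r (X :\ x) z \subset X :\: X2.
    apply/subsetP=> w wz; rewrite inE; have := subsetP (comp_sub r zXx) _ wz.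
    rewrite !inE => /andP[_ ->]; rewrite andbT; apply: contra zX2 => wy.
    have wy' : w \in X2 by rewrite inE.
    by rewrite /X2 -(comp_eq rs wy') (comp_eq rs wz) comp_refl.
  have /connectP[q pq lq] := cX _ _ zX xX.
  have [q1 [w [q2 [Eq aC wC]]]] : exists p1 w p2, [/\ q = p1 ++ w :: p2,
      last z p1 \in component r (X :\ x) z & w \notin component r (X :\ x) z].
    apply: (path_exit (P := fun w => w \in component r (X :\ x) z) pq); first exact: comp_refl.
    by rewrite -lq; apply/negP=> /(subsetP (comp_sub r zXx)); rewrite !inE eqxx.
  have [wX aw] : w \in X /\ r (last z q1) w.
    by move: pq; rewrite Eq cat_path => /andP[_ /andP[/and3P[_ -> ->] _]].
  have wx : w = x.
    apply/eqP; apply: contraNT wC => wx; apply: comp_closed aw => //; by rewrite !inE wx.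
  apply: (@connect_trans _ _ (last z q1)).
    by apply: connect_subset CzX _; apply: comp_conn => //; apply: comp_refl.
  by rewrite wx in aw; apply: connect1; rewrite /rst /= aw xX1 (subsetP CzX).
have c1 : #|X :\: X2| < n.
  rewrite -ltnS; apply: leq_trans Xn; rewrite ltnS; apply: proper_card; apply/properP; split.
    exact: subsetDl.
  by exists y => //; rewrite inE yX2.
have c2 : #|X2| < n.
  rewrite -ltnS; apply: leq_trans Xn; rewrite ltnS; apply: proper_card; apply/properP; split.
    by apply: subset_trans X2X (subsetDl _ _).
  by exists x.
have [p3 [pp3 up3 mp3 lp3]] := IH _ _ c1 xX1 cX1.
have [p4 [pp4 up4 mp4 lp4]] := IH _ _ c2 yX2 cX2.
(* The junction is the walk from [last x p3] over [x] and [y] to [last y p4]. The list ends at [y],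
   a neighbour of [x], which restores the last clause of the induction. *)
exists (p3 ++ rev (y :: p4)); split.
- rewrite cat_path pp3 /= (lastI y p4) rev_rcons /= rev_path.
  rewrite (eq_path (e' := cube)) => [|a b]; last exact: cube_sym.
  rewrite pp4 andbT; apply/existsP; exists x; apply/existsP; exists y.
  by rewrite rxy lp4 rs lp3.
- rewrite -cat_cons cat_uniq up3 rev_uniq up4 andbT /=.
  apply/hasPn=> z; rewrite mem_rev mp4 => zX2; rewrite /= mp3.
  by rewrite inE zX2.
- move=> z; rewrite -cat_cons mem_cat mem_rev mp3 mp4 inE.
  case zX2: (z \in X2); last by rewrite orbF.
  by rewrite orbT; have := subsetP X2X _ zX2; rewrite !inE => /andP[_ ->].
- by rewrite rev_cons last_cat last_rcons.
Qed.

Lemma card_relcomp (r1 r2 : rel T) m1 m2 :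
  (forall x, #|[set y | r1 x y]| <= m1) -> (forall x, #|[set y | r2 x y]| <= m2) ->
  forall x, #|[set y | [exists z, r1 x z && r2 z y]]| <= m1 * m2.
Proof.
move=> h1 h2 x; apply: (@leq_trans (\sum_(z in [set z | r1 x z]) #|[set y | r2 z y]|)).
  apply: (@leq_trans #|\bigcup_(z in [set z | r1 x z]) [set y | r2 z y]|).
    apply: subset_leq_card; apply/subsetP=> y; rewrite inE => /existsP[z /andP[xz zy]].
    by apply/bigcupP; exists z; rewrite inE.
  elim/big_rec2: _ => [|i m A _ H]; first by rewrite cards0.
  by apply: leq_trans (leq_card_setU _ _) _; rewrite leq_add2l.
apply: (@leq_trans (\sum_(z in [set z | r1 x z]) m2)); first exact: leq_sum.
by rewrite sum_nat_const leq_mul2r h1 orbT.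
Qed.

Lemma greedy_colouring (q : rel T) m : symmetric q -> (forall x, #|[set y | q x y]| <= m) ->
  exists c : T -> 'I_m.+1, forall x y, x != y -> q x y -> c x != c y.
Proof.
move=> qs qm.
suff H (W : {set T}) : exists c : T -> 'I_m.+1,
    forall x y, x \in W -> y \in W -> x != y -> q x y -> c x != c y.
  by have [c cP] := H setT; exists c => x y; apply: cP; rewrite inE.
move: {2}#|W| (erefl #|W|) => n; elim: n W => [|n IH] W Wn.
  by exists (fun _ => ord0) => x y; rewrite (cards0_eq Wn) inE.
have /set0Pn[v vW] : W != set0 by rewrite -card_gt0 Wn.
have [c cP] : exists c : T -> 'I_m.+1,
    forall x y, x \in W :\ v -> y \in W :\ v -> x != y -> q x y -> c x != c y.
  by apply: IH; move: Wn; rewrite (cardsD1 v) vW => -[].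
have [k kP] : exists k, k \notin c @: [set y | q v y].
  apply/existsP; rewrite -negb_forall; apply/negP=> /forallP A.
  have : #|'I_m.+1| <= #|c @: [set y | q v y]| by apply: subset_leq_card; apply/subsetP.
  by rewrite card_ord leqNgt ltnS (leq_trans (leq_imset_card _ _) (qm v)).
have kq y : q v y -> c y != k.
  by move=> vy; apply: contraNneq kP => <-; apply: imset_f; rewrite inE.
exists (fun x => if x == v then k else c x) => x y xW yW xy qxy.
have [xv|xv] := eqVneq x v; have [yv|yv] := eqVneq y v.
- by rewrite xv yv eqxx in xy.
- by rewrite eq_sym kq // -xv.
- by rewrite kq // -yv qs.
- by apply: cP => //; rewrite !inE ?xv ?yv.
Qed.

Variable m : nat.
Hypotheses (rm : forall x, #|[set y | r x y]| <= m) (rc : forall x y, connect r x y).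

Lemma card_meet3 x : #|[set y | meet3 x y]| <= m * (m * m) * (m * (m * m)).
Proof.
have h3 z : #|[set y | cube z y]| <= m * (m * m).
  apply: leq_trans (card_relcomp rm (card_relcomp rm rm) z); apply: subset_leq_card.
  apply/subsetP=> y; rewrite !inE => /existsP[a /existsP[b /and3P[A B C]]].
  by apply/existsP; exists a; rewrite A; apply/existsP; exists b; rewrite B.
apply: leq_trans (card_relcomp h3 h3 x); apply: subset_leq_card.
apply/subsetP=> y; rewrite !inE => /existsP[z /andP[A B]].
by apply/existsP; exists z; rewrite cube_sym A.
Qed.

(* [c] colours the vertices and [nx x] is the colour of the successor of [x], which is the only
   vertex of that colour at distance at most 3 from [x]. *)
Lemma coded_order : 0 < #|T| ->
  exists (idx : T -> nat) (c : T -> nat) (nx : T -> option nat),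
  [/\ injective idx, forall x, idx x < #|T|, forall x, c x < (m * (m * m) * (m * (m * m))).+1,
     forall x y, (cube x y && (nx x == Some (c y))) = (idx y == (idx x).+1)
   & forall k, k < #|T| -> exists x, idx x = k].
Proof.
case/card_gt0P=> x0 _.
have [||p [pp up mp _]] := @cube_enum setT x0; first by rewrite inE.
  move=> x y _ _; apply: connect_sub (rc x y) => a b ab; apply: connect1.
  by rewrite /rst /= !inE.
have ms : symmetric meet3.
  by move=> x y; apply/existsP/existsP=> [] [z]; rewrite andbC; exists z.
have [c cP] := greedy_colouring ms card_meet3.
pose s := x0 :: p; have sI x : x \in s by rewrite mp inE.
have ss : size s = #|T|.
  by rewrite -cardsT -(card_uniqP up); apply: eq_card => x; rewrite mp.
pose nx x := if (index x s).+1 < #|T| then Some (c (nth x0 s (index x s).+1) : nat) else None.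
have st i : i.+1 < size s -> cube (nth x0 s i) (nth x0 s i.+1).
  by move=> iS; have /(pathP x0)/(_ i) := pp; apply.
exists (index^~ s), c, nx; split.
- by move=> x y E; rewrite -(nth_index x0 (sI x)) E nth_index.
- by move=> x; rewrite -ss index_mem.
- by move=> x; apply: ltn_ord.
- move=> x y; rewrite /nx; case: ltnP => H; last first.
    rewrite andbF; apply/esym/negbTE; apply: contraTneq H => <-.
    by rewrite -ltnNge -ss index_mem.
  set y' := nth x0 s (index x s).+1.
  have xy' : cube x y' by have := st (index x s); rewrite ss nth_index //; apply.
  have iy' : index y' s = (index x s).+1 by rewrite index_uniq // ss.
  apply/andP/eqP=> [[xy /eqP[E]]|E].
    suff -> : y = y' by [].
    apply/eqP; apply/negPn/negP=> ny; have : meet3 y y' by apply/existsP; exists x; rewrite xy.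
    by move/(cP _ _ ny)/eqP; apply; apply: val_inj.
  have -> : y = y' by rewrite -(nth_index x0 (sI y)) E.
  by rewrite xy' eqxx.
- by move=> k kT; exists (nth x0 s k); rewrite index_uniq // ss.
Qed.

End CubeOrder.

(** * The order formula *)

Section Decidability.
Variables (A : finType) (R : rel A).

(** Satisfaction in a finite structure is decidable, which gives the encoded disjunction [MOr] its
    meaning constructively. *)
Fixpoint msatb (v1 : nat -> A) (v2 : nat -> {set A}) (phi : mso) : bool :=
  match phi with
  | MEq i j => v1 i == v1 j
  | MRel i j => R (v1 i) (v1 j)
  | MIn i X => v1 i \in v2 X
  | MNot p => ~~ msatb v1 v2 p
  | MAnd p q => msatb v1 v2 p && msatb v1 v2 q
  | MEx1 i p => [exists a, msatb (upd v1 i a) v2 p]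
  | MEx2 X p => [exists P, msatb v1 (upd v2 X P) p]
  end.

Lemma msatP v1 v2 phi : reflect (msat R v1 v2 phi) (msatb v1 v2 phi).
Proof.
elim: phi v1 v2 => /= [i j|i j|i X|p IH|p IHp q IHq|i p IH|X p IH] v1 v2; try exact: idP.
- exact: eqP.
- by apply: (iffP negP) => H /IH.
- by apply: (iffP andP) => -[/IHp ? /IHq ?].
- by apply: (iffP existsP) => -[a /IH ?]; exists a.
- by apply: (iffP existsP) => -[a /IH ?]; exists a.
Qed.

Definition MOr p q := MNot (MAnd (MNot p) (MNot q)).

Lemma msat_or v1 v2 p q : msat R v1 v2 (MOr p q) <-> msat R v1 v2 p \/ msat R v1 v2 q.
Proof.
split=> /=; last by case=> H [].
by case: (msatP v1 v2 p) => [|np]; [left|case: (msatP v1 v2 q) => [|nq H]; [right|case: H]].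
Qed.

End Decidability.

(* Set parameters: 0 = all vertices, 1 = the edges of the spanning subgraph, 2 = component
   representatives, 3 + c = vertices of colour c, 3 + N + c = vertices whose successor has colour c. *)
Section OrderFormula.
Variable N : nat.

(** The last disjunct makes the representatives a clique. Bound variables are 20 here, 18 and 19 in
    [f_cube], 16 and 17 in [f_le], 2 to 5 in [f_edge], so nesting captures nothing. *)
Definition f_adj i j :=
  MOr (MEq i j) (MOr (MEx1 20 (MAnd (MIn 20 1) (MAnd (MRel i 20) (MRel j 20))))
                     (MAnd (MIn i 2) (MIn j 2))).
Definition f_cube i j :=
  MEx1 18 (MEx1 19 (MAnd (f_adj i 18) (MAnd (f_adj 18 19) (f_adj 19 j)))).
Fixpoint f_col k i j :=
  if k is k'.+1 then MOr (MAnd (MIn i (3 + N + k')) (MIn j (3 + k'))) (f_col k' i j)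
  else MNot (MEq i i).
Definition f_succ i j := MAnd (f_cube i j) (f_col N i j).
(** Reachability: every set that contains [i] and is closed under successor contains [j]. The index
    of [X] is the first one beyond the parameters. *)
Definition f_le i j := let X := 3 + N + N in
  MNot (MEx2 X (MAnd (MIn i X) (MAnd (MNot (MIn j X))
    (MNot (MEx1 16 (MEx1 17 (MAnd (MIn 16 X) (MAnd (f_succ 16 17) (MNot (MIn 17 X)))))))))).
Definition f_lt i j := MAnd (f_le i j) (MNot (MEq i j)).
(** The strict comparisons list the ends of each edge in increasing order; edges are then compared
    lexicographically. *)
Definition f_edge :=
  MEx1 2 (MEx1 3 (MEx1 4 (MEx1 5
    (MAnd (MAnd (MRel 2 0) (MRel 3 0)) (MAnd (MAnd (MRel 4 1) (MRel 5 1))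
    (MAnd (f_lt 2 3) (MAnd (f_lt 4 5) (MOr (f_lt 2 4) (MAnd (MEq 2 4) (f_le 3 5)))))))))).
Definition f_order :=
  MOr (MAnd (MIn 0 0) (MOr (MNot (MIn 1 0)) (f_le 0 1)))
      (MAnd (MAnd (MNot (MIn 0 0)) (MNot (MIn 1 0))) f_edge).

Lemma fo_free_col (ok : pred nat) k i j : ok i -> ok j -> fo_free_in ok (f_col k i j).
Proof. by move=> oi oj; elim: k => /= [|k IH]; rewrite ?oi ?oj ?IH. Qed.

Lemma so_free_col (ok : pred nat) k i j : k <= N -> (forall l, l < 3 + N + N -> ok l) ->
  so_free_in ok (f_col k i j).
Proof.
move=> kN H; elim: k kN => //= k IH kN; rewrite !H ?IH //; lia.
Qed.

Lemma f_order_free : mso_formula_xy (3 + N + N) f_order.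
Proof.
rewrite /mso_formula_xy; apply/andP; split.
  by rewrite /= !fo_free_col.
have H l : l < 3 + N + N -> (l == 3 + N + N) || (l < 3 + N + N) by move=> ->; rewrite orbT.
by rewrite /= !eqxx /= !so_free_col // !orbT.
Qed.

(** * Meaning of the order formula under suitable parameters *)

Section Semantics.
Variables (G : fin_graph) (r : rel 'I_(gn G)) (idx c : 'I_(gn G) -> nat) (nx : 'I_(gn G) -> option nat).
Variable Z : nat -> {set inc_univ G}.
Notation A := (inc_univ G).
Notation sat := (msat (@inc_rel G)).

Definition adjP (a b : A) := a = b \/ (exists2 d, d \in Z 1 & inc_rel a d /\ inc_rel b d) \/
  (a \in Z 2 /\ b \in Z 2).

Hypothesis (rP : forall x b, adjP (inl x) b <-> exists2 y, b = inl y & r x y).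
Hypothesis (Zc : forall k a, k < N -> (a \in Z (3 + k)) <-> exists2 x, a = inl x & c x = k).
Hypothesis (Zn : forall k a, k < N -> (a \in Z (3 + N + k)) <-> exists2 x, a = inl x & nx x = Some k).
Hypothesis (cN : forall x, c x < N).
Hypothesis (idxS : forall x y, (cube r x y && (nx x == Some (c y))) = (idx y == (idx x).+1)).
Hypothesis (idxI : injective idx).
Hypothesis (idx_sur : forall k, k < gn G -> exists x, idx x = k).
Hypothesis (idxn : forall x, idx x < gn G).

Definition params (v2 : nat -> {set A}) := forall k, k < 3 + N + N -> v2 k = Z k.

Lemma sat_adj (v1 : nat -> A) (v2 : nat -> {set A}) i j : params v2 -> i != 20 -> j != 20 ->
  sat v1 v2 (f_adj i j) <-> adjP (v1 i) (v1 j).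
Proof.
move=> pv i20 j20; rewrite msat_or msat_or /= /upd /= (negbTE i20) (negbTE j20) !pv //.
rewrite /adjP; split=> -[->|[|]]; try by left.
- by move=> [a [A1 [A2 A3]]]; right; left; exists a.
- by move=> [A1 A2]; right; right.
- by move=> [a A1 [A2 A3]]; right; left; exists a.
- by move=> [A1 A2]; right; right.
Qed.

Lemma sat_cube (v1 : nat -> A) (v2 : nat -> {set A}) i j x : params v2 -> i < 18 -> j < 18 -> v1 i = inl x ->
  sat v1 v2 (f_cube i j) <-> exists2 y, v1 j = inl y & cube r x y.
Proof.
move=> pv i18 j18 vx.
have ne k l : k < 18 -> 18 <= l -> (k == l) = false by lia.
rewrite /f_cube /=; split.
  case=> a [b [/sat_adj H1 [/sat_adj H2 /sat_adj H3]]].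
  move: H1 H2 H3; rewrite /upd /= !ne // vx => H1 H2 H3.
  have /rP[x1 Ea xx1] := H1 pv isT isT; rewrite Ea in H2.
  have /rP[x2 Eb xx2] := H2 pv isT isT; rewrite Eb in H3.
  have /rP[y Ey xy] := H3 pv isT isT; exists y => //.
  by apply/existsP; exists x1; apply/existsP; exists x2; rewrite xx1 xx2 xy.
case=> y vy /existsP[a /existsP[b /and3P[xa ab byy]]].
exists (inl a), (inl b); split; [|split]; apply/sat_adj => //; rewrite ?ne // /upd /= ?ne //.
- by rewrite vx; apply/rP; exists a.
- by apply/rP; exists b.
- by rewrite vy; apply/rP; exists y.
Qed.

Lemma sat_col (v1 : nat -> A) (v2 : nat -> {set A}) k i j : params v2 -> k <= N ->
  sat v1 v2 (f_col k i j) <-> exists2 l, l < k & v1 i \in Z (3 + N + l) /\ v1 j \in Z (3 + l).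
Proof.
move=> pv; elim: k => [|k IH] kN.
  by split=> /= [[]//|[]].
have -> : f_col k.+1 i j = MOr (MAnd (MIn i (3 + N + k)) (MIn j (3 + k))) (f_col k i j) by [].
rewrite msat_or IH ?(ltnW kN) //.
have -> : sat v1 v2 (MAnd (MIn i (3 + N + k)) (MIn j (3 + k))) =
  (v1 i \in v2 (3 + N + k) /\ v1 j \in v2 (3 + k)) by [].
rewrite !pv; [|lia|lia].
split=> [[H|[l lk H]]|[l lk H]]; first by exists k.
  by exists l => //; apply: ltnW.
move: lk; rewrite ltnS leq_eqVlt => /orP[/eqP E|lk]; first by left; rewrite -E.
by right; exists l.
Qed.

Lemma sat_succ (v1 : nat -> A) (v2 : nat -> {set A}) i j : params v2 -> i < 18 -> j < 18 ->
  sat v1 v2 (f_succ i j) <-> exists x y, [/\ v1 i = inl x, v1 j = inl y & idx y = (idx x).+1].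
Proof.
move=> pv i18 j18; split.
  case=> [/sat_cube H3 /(sat_col _ _ _ pv (leqnn _))[l lN [/(Zn _ lN)[x vx nxl] /(Zc _ lN)[y vy cy]]]].
  exists x, y; split=> //; apply/eqP; rewrite -idxS nxl cy eqxx andbT.
  by have [y'] := H3 _ pv i18 j18 vx; rewrite vy => -[->].
case=> x [y [vx vy E]]; have := idxS x y; rewrite E eqxx => /andP[xy /eqP nc].
split; first by apply/(sat_cube pv i18 j18 vx); exists y.
apply/(sat_col _ _ _ pv (leqnn _)); exists (c y) => //; split.
  by apply/Zn => //; exists x.
by apply/Zc => //; exists y.
Qed.

Lemma sat_le (v1 : nat -> A) (v2 : nat -> {set A}) i j x y : params v2 -> i < 16 -> j < 16 -> v1 i = inl x -> v1 j = inl y ->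
  sat v1 v2 (f_le i j) <-> idx x <= idx y.
Proof.
move=> pv i16 j16 vx vy; set X := 3 + N + N.
have pu P : params (upd v2 X P).
  by move=> k kN; rewrite /upd ltn_eqF // pv.
have uX P : upd v2 X P X = P by rewrite /upd eqxx.
have ss (P : {set A}) a b : sat (upd (upd v1 16 a) 17 b) (upd v2 X P) (f_succ 16 17) <->
    exists x y, [/\ a = inl x, b = inl y & idx y = (idx x).+1].
  by rewrite sat_succ.
have -> : sat v1 v2 (f_le i j) = ~ exists P : {set A}, (v1 i \in upd v2 X P X) /\
  (~ (v1 j \in upd v2 X P X) /\ ~ exists a b, (a \in upd v2 X P X) /\
    (sat (upd (upd v1 16 a) 17 b) (upd v2 X P) (f_succ 16 17) /\ ~ (b \in upd v2 X P X))) by [].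
split=> [H|xy [P [xP [yP H]]]].
  case: leqP => // yx; exfalso; apply: H.
  (* The vertices from [x] upwards are closed under successor and omit [y]. *)
  exists [set a | if a is inl z then idx x <= idx z else false].
  rewrite uX vx vy !inE leqnn; split=> //; split; first by rewrite leqNgt yx.
  case=> a [b [aP [/ss [z [w [Ea Eb E]]] nb]]].
  by apply: nb; move: aP; rewrite Ea Eb !inE E => zx; apply: leqW.
apply: yP; rewrite uX vy; rewrite uX vx in xP.
suff Hk k z : idx z = k -> idx x <= k -> inl z \in P by apply: Hk xy.
elim: k z => [|k IH] z zk.
  by rewrite leqn0 => /eqP E; rewrite -(idxI (etrans E (esym zk))).
rewrite leq_eqVlt => /orP[/eqP E|xk]; first by rewrite -zk in E; rewrite -(idxI E).
have [z' z'k] : exists z', idx z' = k by apply: idx_sur; have := idxn z; lia.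
have z'P := IH _ z'k xk; apply/negPn/negP=> zP; apply: H; exists (inl z'), (inl z).
split; first by rewrite uX.
split; first by apply/ss; exists z', z; rewrite zk z'k.
by rewrite uX; apply/negP.
Qed.

Lemma sat_lt (v1 : nat -> A) (v2 : nat -> {set A}) i j x y :
  params v2 -> i < 16 -> j < 16 -> v1 i = inl x -> v1 j = inl y ->
  sat v1 v2 (f_lt i j) <-> idx x < idx y.
Proof.
move=> pv i16 j16 vx vy; have -> : sat v1 v2 (f_lt i j) = (sat v1 v2 (f_le i j) /\ ~ (v1 i = v1 j)) by [].
rewrite (sat_le pv i16 j16 vx vy) vx vy ltn_neqAle.
split=> [[-> ne]|/andP[ne ->]].
  by rewrite andbT; apply/eqP=> /idxI E; apply: ne; rewrite E.
by split=> // -[E]; rewrite E eqxx in ne.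
Qed.

Definition emin (d : edge_type G) := minn (idx (val d).1) (idx (val d).2).
Definition emax (d : edge_type G) := maxn (idx (val d).1) (idx (val d).2).

Lemma edge_neq (d : edge_type G) : (val d).1 != (val d).2.
Proof. by case: d => -[x y] /= /andP[xy _]; apply: contraTneq xy => ->; rewrite ltnn. Qed.

Lemma edge_ends (d : edge_type G) x y : inc_rel (inl x) (inr d) -> inc_rel (inl y) (inr d) ->
  idx x < idx y -> idx x = emin d /\ idx y = emax d.
Proof.
rewrite /= /emin /emax => /orP[]/eqP-> /orP[]/eqP->; rewrite ?ltnn // => lt.
  by split; [rewrite (minn_idPl _) // ltnW|rewrite (maxn_idPr _) // ltnW].
by split; [rewrite (minn_idPr _) // ltnW|rewrite (maxn_idPl _) // ltnW].
Qed.

Lemma edge_ends_ex (d : edge_type G) : exists x y, [/\ inc_rel (inl x) (inr d),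
  inc_rel (inl y) (inr d) & idx x < idx y].
Proof.
have ne : idx (val d).1 != idx (val d).2 by apply: contra (edge_neq d) => /eqP/idxI->.
move: ne; rewrite neq_ltn => /orP[] lt.
  by exists (val d).1, (val d).2; rewrite /= !eqxx orbT.
by exists (val d).2, (val d).1; rewrite /= !eqxx orbT.
Qed.

Lemma sat_edge (v1 : nat -> A) (v2 : nat -> {set A}) d d' :
  params v2 -> v1 0 = inr d -> v1 1 = inr d' ->
  sat v1 v2 f_edge <-> emin d < emin d' \/ emin d = emin d' /\ emax d <= emax d'.
Proof.
move=> pv vd vd'.
have -> : sat v1 v2 f_edge = exists a1 a2 a3 a4,
    let w := upd (upd (upd (upd v1 2 a1) 3 a2) 4 a3) 5 a4 in
    (inc_rel a1 (v1 0) /\ inc_rel a2 (v1 0)) /\ ((inc_rel a3 (v1 1) /\ inc_rel a4 (v1 1)) /\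
    (sat w v2 (f_lt 2 3) /\ (sat w v2 (f_lt 4 5) /\
     sat w v2 (MOr (f_lt 2 4) (MAnd (MEq 2 4) (f_le 3 5)))))) by [].
rewrite vd vd'; split.
  case=> [a1 [a2 [a3 [a4]]]]; set w := upd _ 5 a4 => -[[+ +] [[+ +] [+ [+ +]]]].
  case Ex: a1 => [x|//]; case Ex': a2 => [x'|//]; case Ey: a3 => [y|//]; case Ey': a4 => [y'|//].
  move=> xd x'd yd y'd.
  move=> /(sat_lt (i := 2) (j := 3) pv isT isT Ex Ex') lx /(sat_lt (i := 4) (j := 5) pv isT isT Ey Ey') ly.
  have [<- <-] := edge_ends xd x'd lx; have [<- <-] := edge_ends yd y'd ly.
  rewrite msat_or => -[/(sat_lt (i := 2) (j := 4) pv isT isT Ex Ey)|[E /(sat_le (i := 3) (j := 5) pv isT isT Ex' Ey')]]; first by left.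
  by move: E; rewrite /w /= /upd /= Ex Ey => -[->]; right.
have [x [x' [xd x'd lx]]] := edge_ends_ex d; have [y [y' [yd y'd ly]]] := edge_ends_ex d'.
have [<- <-] := edge_ends xd x'd lx; have [<- <-] := edge_ends yd y'd ly.
move=> H; exists (inl x), (inl x'), (inl y), (inl y'); set w := upd _ 5 _.
split=> //; split=> //; split; first exact/(sat_lt (i := 2) (j := 3) pv isT isT (erefl _) (erefl _)).
split; first exact/(sat_lt (i := 4) (j := 5) pv isT isT (erefl _) (erefl _)).
apply/msat_or; case: H => [lt|[E le]].
  by left; apply/(sat_lt (i := 2) (j := 4) pv isT isT (erefl _) (erefl _)).
right; split; first by rewrite /= /w /upd /= (idxI E).
exact/(sat_le (i := 3) (j := 5) pv isT isT (erefl _) (erefl _)).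
Qed.

(** Vertices take the values below [gn G]; edges follow, with [(emin, emax)] read as two digits in
    base [gn G]. *)
Definition key (a : A) :=
  match a with inl v => idx v | inr d => gn G + (emin d * gn G + emax d) end.

Lemma emax_lt d : emax d < gn G.
Proof. by rewrite /emax gtn_max !idxn. Qed.

Lemma lex_leq n p q p' q' : q < n -> q' < n ->
  (p * n + q <= p' * n + q') <-> (p < p' \/ p = p' /\ q <= q').
Proof.
move=> qn q'n; split.
  move=> H; case: (ltngtP p p') => [lt|gt|E]; [by left| |by right; split=> //; move: H; rewrite E leq_add2l].
  have : p'.+1 * n <= p * n by rewrite leq_mul2r gt orbT.
  by rewrite mulSn; lia.
case=> [lt|[-> le]]; last by rewrite leq_add2l.
have : p.+1 * n <= p' * n by rewrite leq_mul2r lt orbT.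
by rewrite mulSn; lia.
Qed.

Lemma key_inj : injective key.
Proof.
move=> [x|d] [y|d'] /=; [by move/idxI->|have := idxn x; lia|have := idxn y; lia|].
move/addnI => E.
have : emin d = emin d' /\ emax d = emax d'.
  have := lex_leq (emin d) (emin d') (emax_lt d) (emax_lt d').
  have := lex_leq (emin d') (emin d) (emax_lt d') (emax_lt d).
  rewrite E leqnn => -[/(_ isT) H1 _] [/(_ isT) H2 _]; lia.
rewrite /emin /emax; case: d d' {E} => -[x y] /= p [[x' y'] /= p'] [E1 E2].
case/andP: (p) => xy _; case/andP: (p') => xy' _.
suff E : (x, y) = (x', y') by congr inr; apply: val_inj.
have [[/idxI-> /idxI->//]|[/idxI E3 /idxI E4]] : (idx x = idx x' /\ idx y = idx y') \/ (idx x = idx y' /\ idx y = idx x').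
  by move: E1 E2; rewrite /minn /maxn; do 2 case: ifP; lia.
by move: xy; rewrite E3 E4 ltnNge ltnW.
Qed.

Hypothesis Z0 : forall a, (a \in Z 0) = (if a is inl _ then true else false).

Lemma sat_order a b v2 : params v2 -> sat (env_xy a b) v2 f_order <-> key a <= key b.
Proof.
move=> pv; set v1 := env_xy a b.
have s1 : sat v1 v2 (MAnd (MIn 0 0) (MOr (MNot (MIn 1 0)) (f_le 0 1))) =
  ((a \in v2 0) /\ sat v1 v2 (MOr (MNot (MIn 1 0)) (f_le 0 1))) by [].
have s2 : sat v1 v2 (MAnd (MAnd (MNot (MIn 0 0)) (MNot (MIn 1 0))) f_edge) =
  ((~ (a \in v2 0) /\ ~ (b \in v2 0)) /\ sat v1 v2 f_edge) by [].
have s3 : sat v1 v2 (MNot (MIn 1 0)) = ~ (b \in v2 0) by [].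
rewrite msat_or s1 s2 msat_or s3 !pv // {s1 s2 s3}.
case Ea: a => [x|d]; case Eb: b => [y|d']; rewrite !Z0.
- have va : v1 0 = inl x by rewrite -Ea.
  have vb : v1 1 = inl y by rewrite -Eb.
  rewrite (sat_le (i := 0) (j := 1) pv isT isT va vb); split=> [[[_ [[]//|]]//|[[]//]]|H].
  by left; split=> //; right.
- by split=> _; [rewrite /key; have := idxn x; lia|left; split=> //; left].
- by split=> [[[]//|[[_ []]//]]|]; rewrite /key; have := idxn y; lia.
- have va : v1 0 = inr d by rewrite -Ea.
  have vb : v1 1 = inr d' by rewrite -Eb.
  rewrite (sat_edge pv va vb) /key leq_add2l (lex_leq _ _ (emax_lt _) (emax_lt _)).
  by split=> [[[]//|[_ //]]|H]; right.
Qed.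

Lemma linear_order_key v2 : params v2 -> linear_order (fun a b => sat (env_xy a b) v2 f_order).
Proof.
move=> pv; split=> [a|a b|a b d|a b]; rewrite ?(sat_order _ _ pv) //.
- by move=> ab ba; apply: key_inj; apply/eqP; rewrite eqn_leq ab.
- exact: leq_trans.
- by case/orP: (leq_total (key a) (key b)); [left|right].
Qed.

End Semantics.
End OrderFormula.

(** * Ordering graphs with linearly bounded separation *)

Section Orderable.
Variables (G : fin_graph) (a b : nat).
Notation V := 'I_(gn G).
Notation e := (gadj G).
Hypothesis sep : forall S : {set V}, #|comps e (~: S)| <= a * #|S| + b.

Definition reps := [set root e x | x : V].
(** Makes the graph connected. The added edges can only merge components of [G - S], so the linear
    bound persists. *)
Definition joined : rel V := fun x y => e x y || (x \in reps) && (y \in reps).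

Lemma gadj_csym : connect_sym e.
Proof. by apply: sym_connect_sym; apply: gsym. Qed.

Lemma card_reps : #|reps| <= b.
Proof.
have H := sep set0; rewrite cards0 muln0 add0n in H; apply: leq_trans H.
have cE x y : connect (rst e (~: set0)) x y = connect e x y.
  by apply: eq_connect => u v; rewrite /rst /= !inE.
have inj : {in reps &, injective (component e (~: set0))}.
  move=> _ _ /imsetP[x _ ->] /imsetP[y _ ->] /setP/(_ (root e y)).
  rewrite !inE !cE connect0 => xy.
  by move: xy => /(rootP gadj_csym); rewrite !(root_root gadj_csym).
rewrite -(card_in_imset inj); apply: subset_leq_card; apply/subsetP=> C /imsetP[x _ ->].
by apply: imset_f; rewrite !inE.
Qed.

Lemma joined_sym : symmetric joined.
Proof. by move=> x y; rewrite /joined gsym andbC. Qed.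

Lemma joined_connect x y : connect joined x y.
Proof.
have sub u v : connect e u v -> connect joined u v.
  by apply: connect_sub => s t st; apply: connect1; rewrite /joined st.
apply: connect_trans (sub _ _ (connect_root e x)) _.
apply: (@connect_trans _ _ (root e y)).
  by apply: connect1; apply/orP; right; rewrite !imset_f.
by apply: sub; rewrite gadj_csym connect_root.
Qed.

(** Degree bound of the walk relation: the vertex itself, the spanning subgraph, and the clique of
    at most [b] representatives. *)
Definition spread := 1 + (a + b + 1).*2 + b.

(** Edges of the spanning subgraph that are not edges of [G] join representatives. Including the
    whole clique of representatives keeps [r] connected and definable from a set of edges and a set
    of vertices. *)
Lemma exists_walk_rel : 0 < gn G -> exists F : {set V * V}, symmetric (fr F) /\
  let r : rel V := fun x y => [|| x == y, fr F x y && e x y | (x \in reps) && (y \in reps)] in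
  [/\ symmetric r, reflexive r, forall x, #|[set y | r x y]| <= spread & forall x y, connect r x y].
Proof.
move=> G0.
have sepj S : #|comps joined (~: S)| <= a * #|S| + b.
  by apply: leq_trans (sep S); apply: comps_mono => [|x y xy]; [exact: joined_sym|rewrite /joined xy].
have [|F [Fs Fe cF dF]] := bounded_degree_spanning joined_sym sepj joined_connect (erefl _).
  by rewrite card_ord.
exists F; split=> // r; split.
- by move=> x y; rewrite /r eq_sym Fs gsym [in X in _ || (_ || X)]andbC.
- by move=> x; rewrite /r eqxx.
- move=> x; apply: (@leq_trans #|[set x] :|: [set y | fr F x y] :|: reps|).
    apply: subset_leq_card; apply/subsetP=> y; rewrite !in_setU !inE.
    by case/or3P=> [/eqP->|/andP[-> _]|/andP[_ ->]]; rewrite ?eqxx ?orbT.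
  apply: leq_trans (leq_card_setU _ _) _; apply: leq_add; last exact: card_reps.
  apply: leq_trans (leq_card_setU _ _) _; apply: leq_add; first by rewrite cards1.
  exact: dF.
- move=> x y; apply: connect_sub (cF x y) => u v uv; apply: connect1.
  by have /orP[H|H] := Fe _ _ uv; rewrite /r ?uv H ?orbT.
Qed.

Definition ncol := (spread * (spread * spread) * (spread * (spread * spread))).+1.

Lemma linear_sep_order : 0 < #|inc_univ G| ->
  exists P : (3 + ncol + ncol).-tuple {set inc_univ G},
    linear_order (fun x y => msat (@inc_rel G) (env_xy x y) (nth set0 P) (f_order ncol)).
Proof.
move=> U0; have G0 : 0 < gn G.
  by have /card_gt0P[[v|[[v w] p]] _] := U0; apply: leq_trans (ltn_ord v).
have [F [Fs]] := exists_walk_rel G0; set r := (fun x y => _) => -[rs rr rm rc].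
have [|idx [c [nx [idxI idxn cN idxS idx_sur]]]] := coded_order rs rr rm rc.
  by rewrite card_ord.
rewrite !card_ord in idxn idx_sur.
pose Z (k : nat) : {set inc_univ G} := match k with
  | 0 => [set u | if u is inl _ then true else false]
  | 1 => [set u | if u is inr d then fr F (val d).1 (val d).2 else false]
  | 2 => [set u | if u is inl x then x \in reps else false]
  | k'.+3 => [set u | if u is inl x then
                 if k' < ncol then c x == k' else nx x == Some (k' - ncol) else false]
  end.
have Z3 k : Z (3 + k) = [set u | if u is inl x then
  if k < ncol then c x == k else nx x == Some (k - ncol) else false] by [].
exists [tuple Z i | i < 3 + ncol + ncol].
apply: (@linear_order_key ncol G r idx c nx Z) => //.
- move=> x u; split.
    case=> [<-|[[]|[]]]; first by exists x.
      case=> [z|d]; rewrite /Z inE // => Fd [/= xd]; case: u => [y|//] /= yd; exists y => //.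
      rewrite /r; have [//|xy /=] := eqVneq x y; apply/orP; left.
      case: d Fd xd yd => -[s t] /= /andP[_ st] Fst /orP[]/eqP Ex /orP[]/eqP Ey; subst x y.
      + by rewrite eqxx in xy.
      + by rewrite Fst.
      + by rewrite Fs Fst gsym.
      + by rewrite eqxx in xy.
    rewrite /Z !inE => xR; case: u => [y|//] yR; exists y => //.
    by rewrite /r xR yR !orbT.
  case=> y -> /or3P[/eqP->|/andP[Fxy exy]|/andP[xR yR]]; first by left.
    right; left; have [lt|gt|E] := ltngtP x y.
    + have p : (x < y) && gadj G x y by rewrite lt.
      by exists (inr (exist _ (x, y) p)); [rewrite /Z inE|rewrite /= !eqxx orbT].
    + have p : (y < x) && gadj G y x by rewrite gt gsym.
      by exists (inr (exist _ (y, x) p)); [rewrite /Z inE /= Fs|rewrite /= !eqxx orbT].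
    + by move: exy; rewrite (val_inj E) girr.
  by right; right; rewrite /Z !inE.
- move=> k u kN; rewrite Z3 inE; split; first by case: u => [x|//]; rewrite kN => /eqP; exists x.
  by case=> x -> <-; rewrite cN eqxx.
- move=> k u kN; rewrite -addnA Z3 inE.
  have E : (ncol + k < ncol) = false by lia.
  have E' : ncol + k - ncol = k by lia.
  split; first by case: u => [x|//]; rewrite E E' => /eqP; exists x.
  by case=> x -> ->; rewrite E E' eqxx.
- by move=> u; rewrite /Z inE.
- move=> k kN; have -> : nth set0 [tuple Z i | i < 3 + ncol + ncol] k = tnth [tuple Z i | i < 3 + ncol + ncol] (Ordinal kN).
    by rewrite (tnth_nth set0).
  by rewrite tnth_mktuple.
Qed.

End Orderable.

Lemma orderable_of_linear_sep (C : graph_class) a b :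
  (forall G, C G -> forall S : {set 'I_(gn G)}, #|comps (gadj G) (~: S)| <= a * #|S| + b) ->
  MSO2_orderable C.
Proof.
move=> H; exists (3 + ncol a b + ncol a b), (f_order (ncol a b)); split.
  exact: f_order_free.
by move=> G CG; apply: linear_sep_order; apply: H.
Qed.

(** * The equivalence *)

Lemma ncompsE (G : fin_graph) (S : {set 'I_(gn G)}) : ncomps S = #|comps (gadj G) (~: S)|.
Proof.
congr #|pred_of_set _|; apply: eq_imset => x; apply/setP=> y; rewrite !inE.
by apply: eq_connect => u v; rewrite /del_rel /rst /= !inE.
Qed.

Lemma leq_ncomps_Sep (G : fin_graph) (S : {set 'I_(gn G)}) k : #|S| <= k -> ncomps S <= Sep G k.
Proof. exact: (@leq_bigmax_cond _ _ (@ncomps G)). Qed.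

Lemma minor_of_Kmodel (H G : fin_graph) : Kmodel (gadj G) setT (gn H) -> minor H G.
Proof.
case=> phi [p0 _ pd pc pa]; exists phi; split=> // u v uv; apply: pa.
by apply: contraTneq uv => ->; rewrite girr.
Qed.

(** [F] is the maximum of [f] up to [gn H], because an attachment clique of more than [gn H]
    vertices would yield [H] as a minor. *)
Lemma SEP_linear (H : fin_graph) (C : graph_class) :
  (forall G, C G -> ~ minor H G) -> has_SEP C ->
  exists a b, forall G, C G -> forall S : {set 'I_(gn G)}, #|comps (gadj G) (~: S)| <= a * #|S| + b.
Proof.
move=> hC [f fP]; pose F := \max_(j < (gn H).+1) f j.
exists (2 ^ gn H + F * 2 ^ 2 ^ gn H), F => G CG S.
apply: comps_linear; [exact: gsym|exact: girr|by move/minor_of_Kmodel; apply: hC|].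
move=> K KH; rewrite -ncompsE; apply: leq_trans (leq_ncomps_Sep (leqnn _)) _.
apply: leq_trans (fP _ CG _) _.
exact: (@leq_bigmax _ (fun j : 'I_(gn H).+1 => f j) (Ordinal (KH : #|K| < (gn H).+1))).
Qed.

Lemma leq_exp_iter n k : k + n <= exp_iter n k.
Proof.
elim: n => [|n IH]; first by rewrite addn0.
rewrite /exp_iter iterS -/(exp_iter n k) addnS.
exact: leq_ltn_trans IH (ltn_expl _ _).
Qed.

Lemma linear_elementary a b : elementary (fun k => a * k + b).
Proof.
(* One exponential sits on top of [k + (a + b)], and [2 ^ k * 2 ^ (a + b)] dominates
   [k.+1 * (a + b).+1]. *)
exists (a + b).+1 => k; rewrite /exp_iter iterS -/(exp_iter (a + b) k).
apply: (@leq_trans (2 ^ (k + (a + b)))); last by rewrite leq_exp2l // leq_exp_iter.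
rewrite expnD; apply: (@leq_trans (k.+1 * (a + b).+1)); first by rewrite mulSn mulnS mulnDr (mulnC a); lia.
by apply: leq_mul; apply: ltn_expl.
Qed.

Theorem theorem4p13 (H : fin_graph) (C : graph_class)
  (hC : forall G, C G -> ~ minor H G) :
  (MSO2_orderable C <-> has_SEP C) /\
  (has_SEP C <-> exists f, elementary f /\ has_SEPf C f).
Proof.
split; split.
- exact: orderable_SEP.
- by move/(SEP_linear hC)=> [a [b ab]]; apply: orderable_of_linear_sep ab.
- move/(SEP_linear hC)=> [a [b ab]]; exists (fun k => a * k + b); split.
    exact: linear_elementary.
  move=> G CG k; apply/bigmax_leqP => S Sk; rewrite ncompsE.
  by apply: leq_trans (ab _ CG S) _; rewrite leq_add2r leq_mul2l Sk orbT.
- by case=> f [_ Hf]; exists f.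
Qed.
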